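(* Let $\mathcal L$ be a 2-z-exact 2-category (in particular with a strong bizero object) satisfying the conditions (DPN) and (NEC). Consider 1-cells $$A\xrightarrow{a}B\xrightarrow{b}C\to 0\quad\text{(top row)},\qquad 0\to X\xrightarrow{c}Y\xrightarrow{d}Z\quad\text{(bottom row)},$$ and vertical 1-cells $f\colon A\to X$, $g\colon B\to Y$, $h\colon C\to Z$, with invertible 2-cells $g\circ a\cong c\circ f$ and $h\circ b\cong d\circ g$, such that both rows are 2-exact and $f$, $g$, $h$ are normal. Then there is a 1-cell $\partial\colon\mathrm{Ker}(h)\to\mathrm{Cok}(f)$ such that the sequence $$\mathrm{Ker}(f)\xrightarrow{\bar a}\mathrm{Ker}(g)\xrightarrow{\bar b}\mathrm{Ker}(h)\xrightarrow{\partial}\mathrm{Cok}(f)\xrightarrow{\underline c}\mathrm{Cok}(g)\xrightarrow{\underline d}\mathrm{Cok}(h)$$ is 2-exact, where $\ker(g)\circ\bar a\cong a\circ\ker(f)$, $\ker(h)\circ\bar b\cong b\circ\ker(g)$, $\underline c\circ\operatorname{coker}(f)\cong\operatorname{coker}(g)\circ c$, $\underline d\circ\operatorname{coker}(g)\cong\operatorname{coker}(h)\circ d$. If $a$ is a 2-kernel of $b$, then $\bar a$ is a 2-kernel of $\bar b$; dually, if $d$ is a 2-cokernel of $c$, then $\underline d$ is a 2-cokernel of $\underline c$. The same holds if (NEC) is replaced by its dual: the composite of two normal 2-monomorphisms is a normal 2-monomorphism.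
   Context: 2-categories are strict; 1-cells are also called morphisms. For 1-cells, $\cong$ means that there is an invertible 2-cell between them. Whiskering is denoted $\star$. A bizero object of a 2-category $\mathcal L$ is an object $0$ such that for every object $A$ the hom-categories $\mathcal L(A,0)$ and $\mathcal L(0,A)$ are equivalent to the terminal category. A 1-cell is null if it factors through $0$; $f\cong 0$ means that $f$ is isomorphic to a null 1-cell. The bizero object is strong if between any two parallel 1-cells that factor through $0$ there is exactly one 2-cell. In a 2-category with a strong bizero object, a 2-kernel of $f\colon A\to B$ is a 1-cell $k\colon K\to A$ with an invertible 2-cell $f\circ k\cong 0$ such that (1) for every $z\colon Z\to A$ with $f\circ z\cong0$ there is $u\colon Z\to K$ with $k\circ u\cong z$; (2) for all $u,v\colon Z\to K$ and every 2-cell $\lambda\colon k\circ u\Rightarrow k\circ v$ there is a unique 2-cell $\mu\colon u\Rightarrow v$ with $k\star\mu=\lambda$. 2-cokernels are defined dually. They are unique up to equivalence and are written $\ker(f)\colon\mathrm{Ker}(f)\to A$ and $\operatorname{coker}(f)\colon B\to\mathrm{Cok}(f)$. A 2-z-exact 2-category is a 2-category with a strong bizero object having all 2-kernels and all 2-cokernels. A normal 2-monomorphism is a 1-cell which is a 2-kernel of some 1-cell; a normal 2-epimorphism is a 1-cell which is a 2-cokernel of some 1-cell. A 1-cell is normal if it is isomorphic to $m\circ e$ with $e$ a normal 2-epimorphism and $m$ a normal 2-monomorphism; this factorisation is unique up to equivalence, and one writes $m=\mathrm{im}(f)$, $e=\mathrm{coim}(f)$. An antinormal pair $(m,e)$ consists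 of a normal 2-monomorphism $m\colon K\to X$ and a normal 2-epimorphism $e\colon X\to R$; its dinversion is $w=\operatorname{coker}(m)\circ\ker(e)\colon\mathrm{Ker}(e)\to\mathrm{Cok}(m)$. (DPN): for every antinormal pair $(m,e)$, the composite $e\circ m$ is normal if and only if the dinversion $\operatorname{coker}(m)\circ\ker(e)$ is normal. (NEC): the composite of two normal 2-epimorphisms is a normal 2-epimorphism. A composable pair $(f,g)$ of normal 1-cells $A\xrightarrow{f}B\xrightarrow{g}C$ is 2-exact in $B$ if $\mathrm{im}(f)$ is a 2-kernel of $g$ (equivalently, $\mathrm{coim}(g)$ is a 2-cokernel of $f$). A sequence of 1-cells is 2-exact if all its 1-cells are normal and it is 2-exact at every position where the condition makes sense (i.e. at every object having both an incoming and an outgoing 1-cell in the sequence). *)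

(* Defs.v *)
Set Implicit Arguments.
Unset Strict Implicit.
Unset Printing Implicit Defensive.

(** * Categories, functors, equivalences *)

Record category := Category {
  obj :> Type;
  mor : obj -> obj -> Type;
  idm : forall x, mor x x;
  cmp : forall x y w, mor y w -> mor x y -> mor x w;
  cmp_idl : forall x y (f : mor x y), cmp (idm y) f = f;
  cmp_idr : forall x y (f : mor x y), cmp f (idm x) = f;
  cmp_assoc : forall x y w t (h : mor w t) (g : mor y w) (f : mor x y),
    cmp h (cmp g f) = cmp (cmp h g) f
}.

Arguments mor {c} x y.
Arguments idm {c} x.
Arguments cmp {c x y w} g f : rename.

Definition invertible {C : category} {x y : C} (f : mor x y) : Prop :=
  exists g : mor y x, cmp g f = idm x /\ cmp f g = idm y.

Definition isomorphic {C : category} (x y : C) : Prop :=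
  exists f : mor x y, invertible f.

Record functor (C D : category) := Functor {
  fobj :> C -> D;
  fmor : forall x y : C, mor x y -> mor (fobj x) (fobj y);
  fmor_id : forall x, fmor (idm x) = idm (fobj x);
  fmor_cmp : forall (x y w : C) (g : mor y w) (f : mor x y),
    fmor (cmp g f) = cmp (fmor g) (fmor f)
}.

Arguments fmor {C D} f {x y} _ : rename.

Definition idF (C : category) : functor C C :=
  @Functor C C (fun x => x) (fun x y f => f)
    (fun x => eq_refl) (fun x y w g f => eq_refl).

Definition compF (C D E : category) (G : functor D E) (F : functor C D) :
  functor C E :=
  @Functor C E (fun x => G (F x)) (fun x y f => fmor G (fmor F f))
    (fun x => eq_trans (f_equal _ (fmor_id F x)) (fmor_id G (F x)))
    (fun x y w g f =>
       eq_trans (f_equal _ (fmor_cmp F g f)) (fmor_cmp G (fmor F g) (fmor F f))).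

Definition naturally_isomorphic (C D : category) (F G : functor C D) : Prop :=
  exists eta : forall x : C, mor (F x) (G x),
    (forall x, invertible (eta x)) /\
    (forall (x y : C) (f : mor x y),
       cmp (fmor G f) (eta x) = cmp (eta y) (fmor F f)).

Definition equivalent_categories (C D : category) : Prop :=
  exists (F : functor C D) (G : functor D C),
    naturally_isomorphic (compF G F) (idF C) /\
    naturally_isomorphic (compF F G) (idF D).

Definition terminal_category : category :=
  @Category unit (fun _ _ => unit) (fun _ => tt) (fun _ _ _ _ _ => tt)
    (fun _ _ f => match f with tt => eq_refl end)
    (fun _ _ f => match f with tt => eq_refl end)
    (fun _ _ _ _ _ _ _ => eq_refl).

(** * Strict 2-categories *)

Definition cast2 {C : category} {x x' y y' : C} (ex : x = x') (ey : y = y')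
  (f : mor x y) : mor x' y' :=
  match ex in _ = u, ey in _ = v return mor u v with eq_refl, eq_refl => f end.

(** The objects of [cell1 A B] are the 1-cells from [A] to [B], its morphisms
    the 2-cells between them, and [cmp] is vertical composition.  Since the
    1-cells [comp1 h (comp1 g f)] and [comp1 (comp1 h g) f] are equal but not
    convertible, the associativity and unit laws of the horizontal composition
    of 2-cells are stated along [cast2]. *)
Record twocat := Twocat {
  ob :> Type;
  cell1 : ob -> ob -> category;
  id1 : forall A, cell1 A A;
  comp1 : forall A B C, cell1 B C -> cell1 A B -> cell1 A C;
  hcomp : forall A B C (g g' : cell1 B C) (f f' : cell1 A B),
    mor g g' -> mor f f' -> mor (comp1 g f) (comp1 g' f');
  hcomp_id : forall A B C (g : cell1 B C) (f : cell1 A B),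
    hcomp (idm g) (idm f) = idm (comp1 g f);
  interchange : forall A B C (g g' g'' : cell1 B C) (f f' f'' : cell1 A B)
      (b' : mor g' g'') (b : mor g g') (a' : mor f' f'') (a : mor f f'),
    hcomp (cmp b' b) (cmp a' a) = cmp (hcomp b' a') (hcomp b a);
  comp1_idl : forall A B (f : cell1 A B), comp1 (id1 B) f = f;
  comp1_idr : forall A B (f : cell1 A B), comp1 f (id1 A) = f;
  comp1_assoc : forall A B C D (h : cell1 C D) (g : cell1 B C) (f : cell1 A B),
    comp1 h (comp1 g f) = comp1 (comp1 h g) f;
  hcomp_idl : forall A B (f f' : cell1 A B) (a : mor f f'),
    cast2 (comp1_idl f) (comp1_idl f') (hcomp (idm (id1 B)) a) = a;
  hcomp_idr : forall A B (f f' : cell1 A B) (a : mor f f'),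
    cast2 (comp1_idr f) (comp1_idr f') (hcomp a (idm (id1 A))) = a;
  hcomp_assoc : forall A B C D (h h' : cell1 C D) (g g' : cell1 B C)
      (f f' : cell1 A B) (c : mor h h') (b : mor g g') (a : mor f f'),
    cast2 (comp1_assoc h g f) (comp1_assoc h' g' f') (hcomp c (hcomp b a))
    = hcomp (hcomp c b) a
}.

Arguments cell1 {t} A B : rename.
Arguments id1 {t} A : rename.
Arguments comp1 {t A B C} g f : rename.
Arguments hcomp {t A B C g g' f f'} b a : rename.

Declare Scope twocat_scope.
Delimit Scope twocat_scope with twocat.
Open Scope twocat_scope.

Notation "g ∘ f" := (comp1 g f) (at level 40, left associativity) : twocat_scope.
Notation "f ⇒ g" := (mor f g) (at level 70, no associativity) : twocat_scope.
Notation "f ≅ g" := (isomorphic f g) (at level 70, no associativity) : twocat_scope.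

Definition whisker_left {L : twocat} {A B C : L} (k : cell1 B C)
  {u v : cell1 A B} (mu : u ⇒ v) : k ∘ u ⇒ k ∘ v := hcomp (idm k) mu.

Definition whisker_right {L : twocat} {A B C : L} {u v : cell1 B C}
  (mu : u ⇒ v) (k : cell1 A B) : u ∘ k ⇒ v ∘ k := hcomp mu (idm k).

(** * Bizero objects, 2-kernels and 2-cokernels *)

Definition bizero {L : twocat} (zero : L) : Prop :=
  forall A : L,
    equivalent_categories (cell1 A zero) terminal_category /\
    equivalent_categories (cell1 zero A) terminal_category.

Definition null {L : twocat} (zero : L) {A B : L} (f : cell1 A B) : Prop :=
  exists (p : cell1 A zero) (q : cell1 zero B), f = q ∘ p.

Definition iso_null {L : twocat} (zero : L) {A B : L} (f : cell1 A B) : Prop :=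
  exists n : cell1 A B, null zero n /\ f ≅ n.

Definition strong_bizero {L : twocat} (zero : L) : Prop :=
  bizero zero /\
  forall (A B : L) (f g : cell1 A B), null zero f -> null zero g ->
    exists! a : f ⇒ g, True.

(** [is_2kernel zero f k]: [k] is a 2-kernel of [f]. *)
Definition is_2kernel {L : twocat} (zero : L) {A B : L} (f : cell1 A B)
  {K : L} (k : cell1 K A) : Prop :=
  iso_null zero (f ∘ k) /\
  (forall (Z : L) (z : cell1 Z A), iso_null zero (f ∘ z) ->
     exists u : cell1 Z K, k ∘ u ≅ z) /\
  (forall (Z : L) (u v : cell1 Z K) (lambda : k ∘ u ⇒ k ∘ v),
     exists! mu : u ⇒ v, whisker_left k mu = lambda).

(** [is_2cokernel zero f q]: [q] is a 2-cokernel of [f]. *)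
Definition is_2cokernel {L : twocat} (zero : L) {A B : L} (f : cell1 A B)
  {Q : L} (q : cell1 B Q) : Prop :=
  iso_null zero (q ∘ f) /\
  (forall (Z : L) (z : cell1 B Z), iso_null zero (z ∘ f) ->
     exists u : cell1 Q Z, u ∘ q ≅ z) /\
  (forall (Z : L) (u v : cell1 Q Z) (lambda : u ∘ q ⇒ v ∘ q),
     exists! mu : u ⇒ v, whisker_right mu q = lambda).

Definition two_z_exact (L : twocat) (zero : L) : Prop :=
  strong_bizero zero /\
  (forall (A B : L) (f : cell1 A B),
     exists (K : L) (k : cell1 K A), is_2kernel zero f k) /\
  (forall (A B : L) (f : cell1 A B),
     exists (Q : L) (q : cell1 B Q), is_2cokernel zero f q).

(** * Normal 1-cells *)

Definition normal_2mono {L : twocat} (zero : L) {K A : L} (m : cell1 K A) : Prop :=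
  exists (B : L) (f : cell1 A B), is_2kernel zero f m.

Definition normal_2epi {L : twocat} (zero : L) {B Q : L} (e : cell1 B Q) : Prop :=
  exists (A : L) (f : cell1 A B), is_2cokernel zero f e.

Definition normal_factorisation {L : twocat} (zero : L) {A B : L}
  (f : cell1 A B) {I : L} (m : cell1 I B) (e : cell1 A I) : Prop :=
  normal_2mono zero m /\ normal_2epi zero e /\ f ≅ m ∘ e.

Definition normal {L : twocat} (zero : L) {A B : L} (f : cell1 A B) : Prop :=
  exists (I : L) (m : cell1 I B) (e : cell1 A I),
    normal_factorisation zero f m e.

Definition antinormal_pair {L : twocat} (zero : L) {K X R : L}
  (m : cell1 K X) (e : cell1 X R) : Prop :=
  normal_2mono zero m /\ normal_2epi zero e.

(** 2-kernels and 2-cokernels being determined only up to equivalence, every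
    choice of [ker e] and [coker m] gives a dinversion of [(m, e)]. *)
Definition dinversion {L : twocat} (zero : L) {K X R : L}
  (m : cell1 K X) (e : cell1 X R) {N Q : L} (w : cell1 N Q) : Prop :=
  exists (k : cell1 N X) (q : cell1 X Q),
    is_2kernel zero e k /\ is_2cokernel zero m q /\ w = q ∘ k.

Definition DPN (L : twocat) (zero : L) : Prop :=
  forall (K X R : L) (m : cell1 K X) (e : cell1 X R),
    antinormal_pair zero m e ->
    forall (N Q : L) (w : cell1 N Q), dinversion zero m e w ->
      (normal zero (e ∘ m) <-> normal zero w).

Definition NEC (L : twocat) (zero : L) : Prop :=
  forall (A B C : L) (e : cell1 A B) (e' : cell1 B C),
    normal_2epi zero e -> normal_2epi zero e' -> normal_2epi zero (e' ∘ e).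

Definition NMC (L : twocat) (zero : L) : Prop :=
  forall (A B C : L) (m : cell1 A B) (m' : cell1 B C),
    normal_2mono zero m -> normal_2mono zero m' -> normal_2mono zero (m' ∘ m).

(** * 2-exact sequences *)

Definition exact_at {L : twocat} (zero : L) {A B C : L}
  (f : cell1 A B) (g : cell1 B C) : Prop :=
  normal zero f /\ normal zero g /\
  exists (I : L) (m : cell1 I B) (e : cell1 A I),
    normal_factorisation zero f m e /\ is_2kernel zero g m.

(** Finite sequences of composable 1-cells. *)
Inductive chain (L : twocat) : L -> L -> Type :=
| cnil (A : L) : chain A A
| ccons (A B C : L) : cell1 A B -> chain B C -> chain A C.

Arguments cnil {L A}.
Arguments ccons {L A B C} f s : rename.

Notation "f ⨾ s" := (ccons f s) (at level 60, right associativity) : twocat_scope.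

Definition exact_head {L : twocat} (zero : L) {A B C : L} (f : cell1 A B)
  (s : chain B C) : Prop :=
  match s in chain B' C' return cell1 A B' -> Prop with
  | cnil => fun _ => True
  | ccons g _ => fun f => exact_at zero f g
  end f.

Fixpoint exact_chain {L : twocat} (zero : L) {A C : L} (s : chain A C) : Prop :=
  match s with
  | cnil => True
  | ccons f s' => normal zero f /\ exact_head zero f s' /\ exact_chain zero s'
  end.

(* Main.v *)
From Stdlib Require Import Setoid Morphisms.
Require Import Defs.

(** Call two 1-cells congruent when an invertible 2-cell joins them. Since 2-cells
    lift uniquely through a 2-kernel, a 2-kernel is a monomorphism up to
    congruence, hence a kernel in the quotient category. Conversely, a kernel [k]
    in the quotient differs from a chosen 2-kernel [k0] of the same arrow by an
    equivalence [u]; equivalences are fully faithful, hence so is [k], which is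
    isomorphic to [k0 ∘ u], and [k] is a 2-kernel ([is_2kernel_iff]). Dually for
    2-cokernels. The theorem is therefore about a category with null arrows,
    kernels and cokernels in which dinversion preserves and reflects normality.

    The third isomorphism theorem [third_iso] holds there: for normal subobjects
    [N ≤ M] of [X] the antinormal pair [M → X → X/N] has a null dinversion, so its
    composite is normal, and [M/N] is the kernel of [X/N → X/M].

    For the snake, replace [A] by the image [M] of [a] and [Z] by the coimage of
    [d] ([coimage_factor], [image_factor]); the rows become short exact and the
    outer ends of the snake are recovered by [snake_left] and its dual. Suppose
    normal epimorphisms compose, and let [F], [G], [H] be the images of [f], [g],
    [h]. The composite [B → C → H] is a normal epimorphism; let [P] be its kernel,
    which contains both [Ker g] and [M]. By [third_iso], [P/M] is [Ker h], and
    [P/Ker g] is the kernel [K] of [G → H]. Now [K] embeds in [X] as the inverse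
    image of [G], and there it contains [F]; so [M → P → K] is normal with image
    [F], and by dinversion [Ker g → P → Ker h] is normal. Likewise [G → Y → Z] is
    the normal arrow [G → H → Z], so by dinversion [X → Y → Cok g] is normal; its
    kernel is [K], so [K/F] is the kernel of [Cok f → Cok g]. Finally [K/F] is also
    the cokernel of [Ker g → Ker h], both being the quotient of [P] by [Ker g] and
    [M] together. The connecting arrow is [Ker h → K/F → Cok f] ([snake_middle]).
    The other composition axiom is the same statement in the opposite category
    ([snake]). *)

(** * Categories with a congruence and null arrows *)

(** A category with a congruence [≃] on its arrows and an ideal [nul] of null
    arrows that are all congruent to one another. It stands for the pointed
    quotient category; keeping composition strictly associative makes
    reassociation an ordinary rewriting step. *)
Record zcat := ZCat {
  zob :> Type;
  hom : zob -> zob -> Type;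
  eqv : forall A B, hom A B -> hom A B -> Prop;
  one : forall A, hom A A;
  comp : forall A B C, hom B C -> hom A B -> hom A C;
  nul : forall A B, hom A B -> Prop;
  eqv_refl : forall A B (f : hom A B), eqv A B f f;
  eqv_sym : forall A B (f g : hom A B), eqv A B f g -> eqv A B g f;
  eqv_trans : forall A B (f g h : hom A B),
    eqv A B f g -> eqv A B g h -> eqv A B f h;
  comp_eqv : forall A B C (g g' : hom B C) (f f' : hom A B),
    eqv B C g g' -> eqv A B f f' -> eqv A C (comp A B C g f) (comp A B C g' f');
  comp_one_l : forall A B (f : hom A B), comp A B B (one B) f = f;
  comp_one_r : forall A B (f : hom A B), comp A A B f (one A) = f;
  comp_assoc : forall A B C D (h : hom C D) (g : hom B C) (f : hom A B),
    comp A B D (comp B C D h g) f = comp A C D h (comp A B C g f);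
  nul_ex : forall A B, exists n : hom A B, nul A B n;
  nul_all : forall A B (f g : hom A B), nul A B f -> nul A B g -> eqv A B f g;
  nul_eqv : forall A B (f g : hom A B), eqv A B f g -> nul A B f -> nul A B g;
  nul_compl : forall A B C (g : hom B C) (f : hom A B),
    nul A B f -> nul A C (comp A B C g f);
  nul_compr : forall A B C (g : hom B C) (f : hom A B),
    nul B C g -> nul A C (comp A B C g f)
}.

Arguments hom {z} A B : rename.
Arguments eqv {z A B} f g : rename.
Arguments one {z} A : rename.
Arguments comp {z A B C} g f : rename.
Arguments nul {z A B} f : rename.
Arguments eqv_sym {z A B f g} _ : rename.
Arguments nul_all {z A B f g} _ _ : rename.
Arguments nul_eqv {z A B f g} _ _ : rename.
Arguments nul_compl {z A B C} g {f} _ : rename.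
Arguments nul_compr {z A B C g} f _ : rename.

Notation "g · f" := (comp g f) (at level 40, left associativity).
Notation "f ≃ g" := (eqv f g) (at level 70, no associativity).

#[local] Instance eqv_equivalence (C : zcat) (A B : C) : Equivalence (@eqv C A B).
Proof.
  split; red; intros; [apply eqv_refl | now apply eqv_sym | now apply eqv_trans with y].
Qed.

#[local] Instance comp_proper (C : zcat) (A B D : C) :
  Proper (eqv ==> eqv ==> eqv) (@comp C A B D).
Proof. intros g g' Hg f f' Hf; now apply comp_eqv. Qed.

#[local] Instance nul_proper (C : zcat) (A B : C) : Proper (eqv ==> iff) (@nul C A B).
Proof. intros f g H; split; apply nul_eqv; [exact H | now symmetry]. Qed.

(** The opposite category; [opp (opp C)] has the objects, arrows and operations of
    [C], so that a lemma applied to [opp C] states its own dual. *)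
Definition opp (C : zcat) : zcat :=
  @ZCat C (fun A B => @hom C B A) (fun A B => @eqv C B A) (@one C)
    (fun A B D g f => @comp C D B A f g) (fun A B => @nul C B A)
    (fun A B => @eqv_refl C B A) (fun A B => @eqv_sym C B A)
    (fun A B => @eqv_trans C B A)
    (fun A B D g g' f f' Hg Hf => @comp_eqv C D B A f f' g g' Hf Hg)
    (fun A B => @comp_one_r C B A) (fun A B => @comp_one_l C B A)
    (fun A B D E h g f => eq_sym (@comp_assoc C E D B A f g h))
    (fun A B => @nul_ex C B A) (fun A B => @nul_all C B A)
    (fun A B => @nul_eqv C B A)
    (fun A B D g f => @nul_compr C D B A f g)
    (fun A B D g f => @nul_compl C D B A f g).

(** Composites are kept nested to the right; [rw H] rewrites with an equation
    whose left-hand side is a composite of two arrows also when further arrows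
    are composed on its right. *)
Lemma reassoc {C : zcat} {A B D E : C} (g : hom B D) (f : hom A B)
  (w : hom A D) (k : hom E A) : g · f ≃ w -> g · (f · k) ≃ w · k.
Proof. intro H. now rewrite <- comp_assoc, H. Qed.

Ltac assoc := repeat rewrite !comp_assoc.
Tactic Notation "rw" uconstr(H) :=
  assoc; first [rewrite H | rewrite (reassoc _ _ _ _ H)]; assoc.
Tactic Notation "rw" "<-" uconstr(H) :=
  assoc; first [rewrite <- H
               | rewrite (reassoc _ _ _ _ (eqv_sym H))]; assoc.

(** Proves that a composite is null when one of its factors is known to be. *)
Ltac nulls :=
  assoc;
  repeat first [assumption | apply nul_compr; assumption
     | rewrite <- comp_assoc; apply nul_compr; assumption
     | apply nul_compl].

(** * Kernels, cokernels and normal arrows *)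

Definition mono {C : zcat} {A B : C} (m : hom A B) : Prop :=
  forall (Z : C) (u v : hom Z A), m · u ≃ m · v -> u ≃ v.

(** Kernels with respect to the null arrows, up to congruence. *)
Definition ker {C : zcat} {A B K : C} (f : hom A B) (k : hom K A) : Prop :=
  nul (f · k) /\
  (forall (Z : C) (z : hom Z A), nul (f · z) -> exists u : hom Z K, k · u ≃ z) /\
  mono k.

(** The dual notions are the same notions in the opposite category, so that
    every lemma about kernels has its dual for free. *)
Definition epi {C : zcat} {A B : C} (e : hom A B) : Prop :=
  @mono (opp C) B A e.

Definition coker {C : zcat} {A B Q : C} (f : hom A B) (q : hom B Q) : Prop :=
  @ker (opp C) B A Q f q.

(** Normal monomorphisms, normal epimorphisms and normal arrows: kernels,
    cokernels, and composites of a kernel after a cokernel. *)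
Definition nmono {C : zcat} {K A : C} (m : hom K A) : Prop :=
  exists (B : C) (f : hom A B), ker f m.

Definition nepi {C : zcat} {B Q : C} (e : hom B Q) : Prop :=
  @nmono (opp C) Q B e.

Definition nmap {C : zcat} {A B : C} (f : hom A B) : Prop :=
  exists (I : C) (m : hom I B) (e : hom A I), nmono m /\ nepi e /\ f ≃ m · e.

(** Invertible up to congruence. *)
Definition inv {C : zcat} {A B : C} (f : hom A B) : Prop :=
  exists g : hom B A, g · f ≃ one A /\ f · g ≃ one B.

(** All kernels and all cokernels exist. *)
Definition z_exact (C : zcat) : Prop :=
  (forall (A B : C) (f : hom A B), exists (K : C) (k : hom K A), ker f k) /\
  (forall (A B : C) (f : hom A B), exists (Q : C) (q : hom B Q), coker f q).

(** Dinversion of antinormal pairs preserves and reflects normal arrows. *)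
Definition dpn (C : zcat) : Prop :=
  forall (K X R N Q : C) (m : hom K X) (e : hom X R) (k : hom N X)
    (q : hom X Q),
    nmono m -> nepi e -> ker e k -> coker m q -> nmap (e · m) <-> nmap (q · k).

(** Normal epimorphisms compose; [nec (opp C)] is the same for normal
    monomorphisms. *)
Definition nec (C : zcat) : Prop :=
  forall (A B D : C) (e : hom A B) (e' : hom B D),
    nepi e -> nepi e' -> nepi (e' · e).

Lemma z_exact_opp (C : zcat) : z_exact C -> z_exact (opp C).
Proof. intros [Hk Hq]; split; intros A B f; [apply Hq | apply Hk]. Qed.

Lemma nmap_opp {C : zcat} {A B : C} (f : hom A B) :
  nmap f <-> @nmap (opp C) B A f.
Proof. split; intros (I & m & e & Hm & He & H); now exists I, e, m. Qed.

Lemma dpn_opp (C : zcat) : dpn C -> dpn (opp C).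
Proof.
  intros H K X R N Q m e k q Hm He Hk Hq.
  assert (E := H R X K Q N e m q k He Hm Hq Hk).
  split; intro F; apply nmap_opp, E, nmap_opp, F.
Qed.

Lemma ker_mono {C : zcat} {A B K : C} (f : hom A B) (k : hom K A) :
  ker f k -> mono k.
Proof. now intros (_ & _ & H). Qed.

Lemma ker_nul {C : zcat} {A B K : C} (f : hom A B) (k : hom K A) :
  ker f k -> nul (f · k).
Proof. now intros (H & _). Qed.

Lemma ker_lift {C : zcat} {A B K : C} {f : hom A B} {k : hom K A} :
  ker f k -> forall (Z : C) (z : hom Z A), nul (f · z) ->
  exists u : hom Z K, k · u ≃ z.
Proof. now intros (_ & H & _). Qed.

Lemma mono_nul {C : zcat} {A B D : C} {m : hom B D} {f : hom A B} :
  mono m -> nul (m · f) -> nul f.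
Proof.
  intros Hm H. destruct (nul_ex C A B) as [n Hn].
  rewrite (Hm _ f n); [exact Hn|].
  apply nul_all; [exact H | now apply nul_compl].
Qed.

Lemma ker_nmono {C : zcat} {A B K : C} (f : hom A B) (k : hom K A) :
  ker f k -> nmono k.
Proof. intro H; now exists B, f. Qed.

Lemma epi_right {C : zcat} {A B Z : C} {e : hom A B} {u v : hom B Z} :
  epi e -> u · e ≃ v · e -> u ≃ v.
Proof. intros H. exact (H Z u v). Qed.

Lemma epi_nul {C : zcat} {A B D : C} {e : hom A B} {f : hom B D} :
  epi e -> nul (f · e) -> nul f.
Proof. exact (@mono_nul (opp C) D B A e f). Qed.

Lemma coker_nul {C : zcat} {A B Q : C} {f : hom A B} {q : hom B Q} :
  coker f q -> nul (q · f).
Proof. now intros (H & _). Qed.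

Lemma coker_desc {C : zcat} {A B Q : C} {f : hom A B} {q : hom B Q} :
  coker f q -> forall (Z : C) (z : hom B Z), nul (z · f) ->
  exists u : hom Q Z, u · q ≃ z.
Proof. now intros (_ & H & _). Qed.

Lemma coker_epi {C : zcat} {A B Q : C} {f : hom A B} {q : hom B Q} :
  coker f q -> epi q.
Proof. now intros (_ & _ & H). Qed.

Lemma coker_intro {C : zcat} {A B Q : C} {f : hom A B} {q : hom B Q} :
  nul (q · f) ->
  (forall (Z : C) (z : hom B Z), nul (z · f) -> exists u : hom Q Z, u · q ≃ z) ->
  epi q -> coker f q.
Proof. now intros H1 H2 H3; split; [|split]. Qed.

Lemma coker_nepi {C : zcat} {A B Q : C} {f : hom A B} {q : hom B Q} :
  coker f q -> nepi q.
Proof. exact (ker_nmono (C := opp C) f q). Qed.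

Lemma nmono_mono {C : zcat} {A B : C} (m : hom A B) : nmono m -> mono m.
Proof. intros (D & f & H). exact (ker_mono _ _ H). Qed.

Lemma nepi_epi {C : zcat} {A B : C} (e : hom A B) : nepi e -> epi e.
Proof. exact (nmono_mono (C := opp C) e). Qed.

Lemma mono_comp {C : zcat} {A B D : C} (m : hom B D) (n : hom A B) :
  mono m -> mono n -> mono (m · n).
Proof.
  intros Hm Hn Z u v H. apply Hn, Hm. now rewrite <- !comp_assoc.
Qed.

Lemma mono_cancel {C : zcat} {A B D : C} (m : hom B D) (n : hom A B) :
  mono (m · n) -> mono n.
Proof. intros H Z u v E. apply H. assoc. now rewrite E. Qed.

Lemma epi_cancel {C : zcat} {A B D : C} (e : hom A B) (g : hom B D) :
  epi (g · e) -> epi g.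
Proof. exact (@mono_cancel (opp C) D B A e g). Qed.

Lemma mono_eqv {C : zcat} {A B : C} (m n : hom A B) :
  m ≃ n -> mono m -> mono n.
Proof. intros E H Z u v F. apply H. now rewrite !E. Qed.

Lemma epi_eqv {C : zcat} {A B : C} (d e : hom A B) :
  d ≃ e -> epi d -> epi e.
Proof. exact (@mono_eqv (opp C) B A d e). Qed.

Lemma ker_eqv {C : zcat} {A B K : C} {f f' : hom A B} {k k' : hom K A} :
  f ≃ f' -> k ≃ k' -> ker f k -> ker f' k'.
Proof.
  intros Ef Ek (H1 & H2 & H3). split; [|split].
  - now rewrite <- Ef, <- Ek.
  - intros Z z Hz. rewrite <- Ef in Hz. destruct (H2 Z z Hz) as [u Hu].
    exists u. now rewrite <- Ek.
  - exact (mono_eqv _ _ Ek H3).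
Qed.

Lemma nmono_eqv {C : zcat} {K A : C} {m m' : hom K A} :
  m ≃ m' -> nmono m -> nmono m'.
Proof.
  intros E (B & f & H). exists B, f. revert H. now apply ker_eqv.
Qed.

Lemma nmap_eqv {C : zcat} {A B : C} {f g : hom A B} : f ≃ g -> nmap f -> nmap g.
Proof.
  intros E (I & m & e & Hm & He & H). exists I, m, e.
  split; [|split]; trivial. now rewrite <- E.
Qed.

(** A kernel is the kernel of its cokernel. *)
Lemma nmono_ker_coker {C : zcat} {K A Q : C} {m : hom K A} {q : hom A Q} :
  nmono m -> coker m q -> ker q m.
Proof.
  intros (B & f & H1 & H2 & H3) Hq. split; [|split]; trivial.
  { exact (coker_nul Hq). }
  intros Z z Hz. apply H2. destruct (coker_desc Hq _ _ H1) as [t Ht].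
  rewrite <- Ht. nulls.
Qed.

Lemma ker_mono_comp {C : zcat} {A B D K : C} {m : hom B D} {e : hom A B}
  {k : hom K A} : mono m -> ker (m · e) k <-> ker e k.
Proof.
  intro Hm. split; intros (H1 & H2 & H3); split; try split; trivial.
  - rewrite comp_assoc in H1. exact (mono_nul Hm H1).
  - intros Z z Hz. apply H2. nulls.
  - nulls.
  - intros Z z Hz. rewrite comp_assoc in Hz. apply H2, (mono_nul Hm Hz).
Qed.

Lemma nmono_cancel {C : zcat} {A B D : C} (m : hom B D) (n : hom A B) :
  mono m -> nmono (m · n) -> nmono n.
Proof.
  intros Hm (E & t & H1 & H2 & H3). exists E, (t · m). split; [|split].
  - now rewrite comp_assoc.
  - intros Z z Hz. rewrite comp_assoc in Hz.
    destruct (H2 _ _ Hz) as [u Hu]. exists u. apply Hm.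
    now rewrite <- comp_assoc.
  - exact (mono_cancel _ _ H3).
Qed.

(** The image of [m · g] is killed by the cokernel of [m], so it lies in [m] when
    [m] is a normal monomorphism. *)
Lemma nmap_cancel {C : zcat} (HC : z_exact C) {A B D : C} (m : hom B D)
  (g : hom A B) : nmono m -> nmap (m · g) -> nmap g.
Proof.
  intros Hm (I & m' & e' & Hm' & He' & H).
  destruct (proj2 HC _ _ m) as (Q & q & Hq).
  assert (Kq := nmono_ker_coker Hm Hq).
  assert (N : nul (q · m')).
  { apply (epi_nul (nepi_epi _ He')). rewrite comp_assoc, <- H, <- comp_assoc.
    apply nul_compr, (ker_nul _ _ Kq). }
  destruct (ker_lift Kq _ _ N) as [x Hx].
  exists I, x, e'. split; [|split; trivial].
  - apply (nmono_cancel m); [now apply nmono_mono|].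
    exact (nmono_eqv (eqv_sym Hx) Hm').
  - apply (nmono_mono _ Hm). now rewrite H, <- Hx, comp_assoc.
Qed.

(** Two kernels of the same arrow differ by an invertible arrow. *)
Lemma ker_unique {C : zcat} {A B K K' : C} {f : hom A B} {k : hom K A}
  {k' : hom K' A} : ker f k -> ker f k' ->
  exists u : hom K K', inv u /\ k' · u ≃ k.
Proof.
  intros (H1 & H2 & H3) (H1' & H2' & H3').
  destruct (H2' _ _ H1) as [u Hu]. destruct (H2 _ _ H1') as [v Hv].
  exists u. split; trivial. exists v. split.
  - apply H3. rewrite <- comp_assoc, Hv, Hu, comp_one_r. reflexivity.
  - apply H3'. rewrite <- comp_assoc, Hu, Hv, comp_one_r. reflexivity.
Qed.

Lemma ker_inv {C : zcat} {A B K K' : C} {f : hom A B} {k : hom K A}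
  {u : hom K' K} : ker f k -> inv u -> ker f (k · u).
Proof.
  intros (H1 & H2 & H3) (v & Hvu & Huv). split; [|split].
  - rewrite <- comp_assoc. now apply nul_compr.
  - intros Z z Hz. destruct (H2 _ _ Hz) as [w Hw]. exists (v · w).
    rw Huv. now rewrite comp_one_l.
  - apply mono_comp; trivial. intros Z x y E.
    rewrite <- (comp_one_l _ _ _ x), <- (comp_one_l _ _ _ y), <- Hvu.
    assoc. now rewrite E.
Qed.

(** A null arrow factors through the cokernel of an identity, which is a zero
    object. *)
Lemma nul_nmap {C : zcat} (HC : z_exact C) {A B : C} (f : hom A B) :
  nul f -> nmap f.
Proof.
  intro Hf. destruct (proj2 HC _ _ (one A)) as (E & e & He).
  destruct (nul_ex C E B) as [m Hm].
  assert (Ne : nul e).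
  { assert (N := coker_nul He). now rewrite comp_one_r in N. }
  assert (N1 : nul (one E)).
  { apply (epi_nul (coker_epi He)). now rewrite comp_one_l. }
  assert (NE : forall (Z : C) (u : hom Z E), nul u).
  { intros Z u. rewrite <- (comp_one_l _ _ _ u). now apply nul_compr. }
  exists E, m, e. split; [|split].
  - exists B, (one B). split; [|split].
    + nulls.
    + intros Z z Hz. rewrite comp_one_l in Hz.
      destruct (nul_ex C Z E) as [n Hn]. exists n.
      apply nul_all; [nulls | trivial].
    + intros Z u v _. apply nul_all; apply NE.
  - now exists A, (one A).
  - apply nul_all; [trivial | nulls].
Qed.

(** The third isomorphism theorem: for normal subobjects [n] and [m] of [X]
    with [n] contained in [m], the quotient of [m] by [n] is the kernel of the
    induced arrow [q'] from [X/n] to [X/m]. The dinversion of the antinormal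
    pair [(m, e)] is null, whence [e · m] is normal. *)
Lemma third_iso {C : zcat} (HC : z_exact C) (HD : dpn C) {N M X R Q I : C}
  {n : hom N X} {m : hom M X} {n' : hom N M} {e : hom X R} {q : hom X Q}
  {q' : hom R Q} {m' : hom I R} :
  ker e n -> coker n e -> n ≃ m · n' -> ker q m -> coker m q ->
  q' · e ≃ q -> ker q' m' ->
  exists e' : hom M I, e · m ≃ m' · e' /\ coker n' e' /\ ker e' n'.
Proof.
  intros Kn Qe En Km Qm Eq Km'.
  assert (Hnm : nmap (e · m)).
  { apply (HD _ _ _ _ _ m e n q); trivial.
    - exact (ker_nmono _ _ Km).
    - exact (coker_nepi Qe).
    - apply nul_nmap; trivial. rewrite En, <- comp_assoc.
      apply nul_compr, (ker_nul _ _ Km). }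
  destruct Hnm as (J & m0 & e0 & Hm0 & He0 & E0).
  assert (Ee0 : epi e0) by exact (nepi_epi _ He0).
  assert (Ee : epi e) by exact (coker_epi Qe).
  assert (K0 : ker e0 n').
  { apply (ker_mono_comp (nmono_mono _ Hm0)).
    apply (ker_eqv E0 (reflexivity n')). split; [|split].
    - rewrite comp_assoc, <- En. exact (ker_nul _ _ Kn).
    - intros Z z Hz. rewrite comp_assoc in Hz.
      destruct (ker_lift Kn _ _ Hz) as [u Hu]. exists u.
      apply (ker_mono _ _ Km). now rewrite <- comp_assoc, <- En.
    - apply (mono_cancel m), (mono_eqv n); trivial. exact (ker_mono _ _ Kn). }
  assert (Q0 : coker n' e0) by exact (nmono_ker_coker (C := opp C) He0 K0).
  assert (Qm0 : coker m0 q').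
  { apply coker_intro.
    - apply (epi_nul Ee0).
      rewrite comp_assoc, <- E0, <- comp_assoc, Eq. exact (ker_nul _ _ Km).
    - intros Z z Hz.
      assert (Hz' : nul (z · e · m)).
      { rewrite comp_assoc, E0, <- comp_assoc. now apply nul_compr. }
      destruct (coker_desc Qm _ _ Hz') as [u Hu]. exists u.
      apply (epi_right Ee). now rewrite comp_assoc, Eq.
    - apply (epi_cancel e), (epi_eqv q); [now symmetry | exact (coker_epi Qm)]. }
  destruct (ker_unique (nmono_ker_coker Hm0 Qm0) Km') as (u & Hu & Eu).
  exists (u · e0). split; [|split].
  - now rewrite <- comp_assoc, Eu.
  - apply (ker_inv (C := opp C) Q0).
    destruct Hu as (v & H1 & H2). exists v. now split.
  - apply ker_mono_comp; trivial.
    destruct Hu as (v & H1 & H2). intros Z x y E.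
    rewrite <- (comp_one_l _ _ _ x), <- (comp_one_l _ _ _ y), <- H1.
    assoc. now rewrite E.
Qed.

Lemma nepi_coker_ker {C : zcat} {B Q K : C} {e : hom B Q} {k : hom K B} :
  nepi e -> ker e k -> coker k e.
Proof. exact (@nmono_ker_coker (opp C) Q B K e k). Qed.

Lemma coker_eqv {C : zcat} {A B Q : C} {f f' : hom A B} {q q' : hom B Q} :
  f ≃ f' -> q ≃ q' -> coker f q -> coker f' q'.
Proof. exact (@ker_eqv (opp C) B A Q f f' q q'). Qed.

Lemma coker_epi_comp {C : zcat} {A B D Q : C} {e : hom A B} {m : hom B D}
  {q : hom D Q} : epi e -> coker (m · e) q <-> coker m q.
Proof. exact (@ker_mono_comp (opp C) D B A Q e m q). Qed.

Lemma nepi_cancel {C : zcat} {A B D : C} (e : hom A B) (g : hom B D) :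
  epi e -> nepi (g · e) -> nepi g.
Proof. exact (@nmono_cancel (opp C) D B A e g). Qed.

Lemma nepi_eqv {C : zcat} {B Q : C} {e e' : hom B Q} :
  e ≃ e' -> nepi e -> nepi e'.
Proof. exact (@nmono_eqv (opp C) Q B e e'). Qed.

Lemma nmap_cancel_nepi {C : zcat} (HC : z_exact C) {A B D : C} (e : hom A B)
  (g : hom B D) : nepi e -> nmap (g · e) -> nmap g.
Proof.
  intros He Hg. apply nmap_opp, (nmap_cancel (z_exact_opp _ HC) e g He).
  now apply (nmap_opp (C := C)).
Qed.

(** Exactness of a pair of normal arrows, in a form that is its own dual. *)
Definition exact {C : zcat} {A B D : C} (f : hom A B) (g : hom B D) : Prop :=
  exists (I J : C) (m : hom I B) (e : hom A I) (n : hom J D) (q : hom B J),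
    (nmono m /\ nepi e /\ f ≃ m · e) /\ (nmono n /\ nepi q /\ g ≃ n · q) /\
    ker q m /\ coker m q.

Lemma exact_opp {C : zcat} {A B D : C} (f : hom A B) (g : hom B D) :
  @exact (opp C) D B A g f -> exact f g.
Proof.
  intros (I & J & m & e & n & q & (H1 & H2 & H3) & (H4 & H5 & H6) & H7 & H8).
  now exists J, I, q, n, e, m.
Qed.

Lemma exact_eqv {C : zcat} {A B D : C} {f f' : hom A B} {g g' : hom B D} :
  f ≃ f' -> g ≃ g' -> exact f g -> exact f' g'.
Proof.
  intros Ef Eg (I & J & m & e & n & q & (H1 & H2 & H3) & (H4 & H5 & H6) & H).
  exists I, J, m, e, n, q. now rewrite <- Ef, <- Eg.
Qed.

(** For [f] normal and [n] a normal monomorphism, [f] and [n · q] are exact as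
    soon as [q] is a cokernel of [f]. *)
Lemma exact_of_coker {C : zcat} {A B D J : C} {f : hom A B} {g : hom B D}
  {n : hom J D} {q : hom B J} :
  nmap f -> nmono n -> g ≃ n · q -> coker f q -> exact f g.
Proof.
  intros (I & m & e & Hm & He & Ef) Hn Eg Hq.
  assert (Qm : coker m q).
  { apply (coker_epi_comp (nepi_epi _ He)).
    now apply (coker_eqv Ef (reflexivity q)). }
  exists I, J, m, e, n, q.
  exact (conj (conj Hm (conj He Ef)) (conj (conj Hn (conj (coker_nepi Hq) Eg))
    (conj (nmono_ker_coker Hm Qm) Qm))).
Qed.

Lemma exact_of_ker {C : zcat} {A B D I : C} {f : hom A B} {g : hom B D}
  {m : hom I B} {e : hom A I} :
  nmap g -> nepi e -> f ≃ m · e -> ker g m -> exact f g.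
Proof.
  intros Hg He Ef Hm. apply exact_opp.
  apply (exact_of_coker (C := opp C) (n := e) (q := m)); trivial.
  now apply (nmap_opp (C := C)).
Qed.

(** * The outer parts of the snake *)

(** The kernel of the arrow [b1] induced between the kernels of [g] and of the
    third vertical arrow is the intersection of the kernels of [g] and of [b];
    as [c] is a monomorphism, it is the kernel of [t]. *)
Lemma ker_pullback {C : zcat} {A B D X Y Kt Kg Kh : C} {m : hom A B}
  {b : hom B D} {c : hom X Y} {t : hom A X} {g : hom B Y} {kt : hom Kt A}
  {kg : hom Kg B} {kh : hom Kh D} {a1 : hom Kt Kg} {b1 : hom Kg Kh} :
  ker b m -> mono c -> g · m ≃ c · t -> ker t kt -> ker g kg -> mono kh ->
  kg · a1 ≃ m · kt -> kh · b1 ≃ b · kg -> ker b1 a1.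
Proof.
  intros Km Hc E Kt' Kg' Hkh Ea Eb.
  apply (ker_mono_comp Hkh), (ker_eqv (eqv_sym Eb) (reflexivity a1)).
  split; [|split].
  - rw Ea. rewrite <- comp_assoc. apply nul_compr, (ker_nul _ _ Km).
  - intros Z z Hz. rewrite comp_assoc in Hz.
    destruct (ker_lift Km _ _ Hz) as [y Hy].
    assert (Ny : nul (t · y)).
    { apply (mono_nul Hc). rewrite <- comp_assoc, <- E, comp_assoc, Hy.
      rewrite <- comp_assoc. apply nul_compr, (ker_nul _ _ Kg'). }
    destruct (ker_lift Kt' _ _ Ny) as [w Hw]. exists w.
    apply (ker_mono _ _ Kg'). rw Ea. now rewrite Hw.
  - apply (mono_cancel kg), (mono_eqv (m · kt)); [now symmetry|].
    apply mono_comp; eapply ker_mono; eassumption.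
Qed.

(** When [m · ae] and [fm · fe] are the normal factorisations of [a] and [f], the
    coimage of [f] factors through that of [a], so that [fm · s] is the arrow
    induced by [f] on the image of [a]. *)
Lemma coimage_factor {C : zcat} (HC : z_exact C) {A M B X Y F : C}
  {ae : hom A M} {m : hom M B} {c : hom X Y} {g : hom B Y} {fe : hom A F}
  {fm : hom F X} :
  nepi ae -> mono c -> mono fm -> nepi fe ->
  g · (m · ae) ≃ c · (fm · fe) ->
  exists s : hom M F, s · ae ≃ fe /\ nepi s /\ g · m ≃ c · (fm · s).
Proof.
  intros Hae Hc Hfm Hfe E. destruct (proj1 HC _ _ ae) as (K & k & Kk).
  assert (N : nul (fe · k)).
  { apply (mono_nul Hfm), (mono_nul Hc).
    rewrite <- (comp_assoc _ _ _ _ _ fm), <- (comp_assoc _ _ _ _ _ c), <- E.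
    assoc. apply nul_compl, nul_compl, (ker_nul _ _ Kk). }
  destruct (coker_desc (nepi_coker_ker Hae Kk) _ _ N) as [s Hs].
  assert (Eae := nepi_epi _ Hae).
  exists s. split; [|split]; trivial.
  - exact (nepi_cancel ae s Eae (nepi_eqv (eqv_sym Hs) Hfe)).
  - apply (epi_right Eae). assoc. now rewrite E, Hs.
Qed.

(** The kernel of [f] covers the kernel of the arrow induced by [f] on the image
    of [a], and the latter is the kernel of [b1]. *)
Lemma snake_left {C : zcat} (HC : z_exact C) (HD : dpn C)
  {A M B D X Y F Kf Kg Kh : C}
  {ae : hom A M} {m : hom M B} {b : hom B D} {c : hom X Y} {g : hom B Y}
  {fe : hom A F} {fm : hom F X}
  {kf : hom Kf A} {kg : hom Kg B} {kh : hom Kh D}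
  {a1 : hom Kf Kg} {b1 : hom Kg Kh} :
  nepi ae -> ker b m -> mono c -> mono fm -> nepi fe ->
  g · (m · ae) ≃ c · (fm · fe) ->
  ker fe kf -> ker g kg -> mono kh ->
  kg · a1 ≃ m · ae · kf -> kh · b1 ≃ b · kg ->
  exists (K : C) (k : hom K Kg) (e : hom Kf K),
    ker b1 k /\ nepi e /\ a1 ≃ k · e.
Proof.
  intros Hae Km Hc Hfm Hfe E Kkf Kkg Hkh Ea Eb.
  destruct (coimage_factor HC Hae Hc Hfm Hfe E) as (s & Es & Hs & Eg).
  destruct (proj1 HC _ _ s) as (K & ks & Kks).
  destruct (proj1 HC _ _ ae) as (Ka & ka & Kka).
  assert (N : nul (fe · ka)).
  { rewrite <- Es, comp_assoc. apply nul_compl, (ker_nul _ _ Kka). }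
  destruct (ker_lift Kkf _ _ N) as [n' Hn'].
  destruct (third_iso HC HD Kka (nepi_coker_ker Hae Kka) (eqv_sym Hn') Kkf
              (nepi_coker_ker Hfe Kkf) Es Kks) as (e & Ee & Qe & _).
  assert (Ng : nul (g · (m · ks))).
  { rw Eg. apply nul_compl, nul_compl, (ker_nul _ _ Kks). }
  destruct (ker_lift Kkg _ _ Ng) as [k Hk].
  exists K, k, e. split; [|split].
  - refine (ker_pullback (t := fm · s) Km Hc Eg _ Kkg Hkh Hk Eb).
    now apply ker_mono_comp.
  - exact (coker_nepi Qe).
  - apply (ker_mono _ _ Kkg). rw Ea. rw Hk. now rewrite Ee.
Qed.

(** The dual of [coimage_factor]. *)
Lemma image_factor {C : zcat} (HC : z_exact C) {B D Y V Z H : C}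
  {b : hom B D} {g : hom B Y} {de : hom Y V} {dm : hom V Z} {he : hom D H}
  {hm : hom H Z} :
  nmono dm -> epi b -> epi he -> nmono hm ->
  dm · de · g ≃ hm · he · b ->
  exists r : hom H V, dm · r ≃ hm /\ nmono r /\ de · g ≃ r · he · b.
Proof.
  exact (@coimage_factor (opp C) (z_exact_opp _ HC) Z V Y D B H dm de b g hm he).
Qed.

(** * The middle of the snake *)

(** The snake of a morphism of short exact sequences with normal components
    [fm · s], [gm · ge] and [r · he]: the induced arrows are normal, and the
    cokernel of [b1] has the same object as the kernel of [c1]. *)
Lemma snake_middle {C : zcat} (HC : z_exact C) (HD : dpn C) (HN : nec C)
  {M B D X Y V F G H Kg Kh Qf Qg : C}
  {m : hom M B} {b : hom B D} {c : hom X Y} {d : hom Y V}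
  {s : hom M F} {fm : hom F X} {ge : hom B G} {gm : hom G Y}
  {he : hom D H} {r : hom H V}
  {kg : hom Kg B} {kh : hom Kh D} {qf : hom X Qf} {qg : hom Y Qg}
  {b1 : hom Kg Kh} {c1 : hom Qf Qg} :
  ker b m -> coker m b -> ker d c -> coker c d ->
  nepi s -> nmono fm -> nepi ge -> nmono gm -> nepi he -> nmono r ->
  gm · (ge · m) ≃ c · (fm · s) -> d · (gm · ge) ≃ r · (he · b) ->
  ker ge kg -> ker he kh -> coker fm qf -> coker gm qg ->
  kh · b1 ≃ b · kg -> c1 · qf ≃ qg · c ->
  nmap b1 /\ nmap c1 /\
  exists (K : C) (de : hom Kh K) (dm : hom K Qf), coker b1 de /\ ker c1 dm.
Proof.
  intros Km Qm Kc Qc Hs Hfm Hge Hgm Hhe Hr E1 E2 Kkg Kkh Qqf Qqg Eb Ec.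
  assert (Ege := nepi_epi _ Hge). assert (Es := nepi_epi _ Hs).
  assert (Mgm := nmono_mono _ Hgm). assert (Mfm := nmono_mono _ Hfm).
  assert (Mr := nmono_mono _ Hr). assert (Mc := ker_mono _ _ Kc).
  assert (Hhb : nepi (he · b)) by exact (HN _ _ _ _ _ (coker_nepi Qm) Hhe).
  destruct (proj1 HC _ _ (he · b)) as (P & p & Kp).
  assert (Qp := nepi_coker_ker Hhb Kp).
  (* [l] is the induced arrow between the images of [g] and [h]. *)
  assert (Nl : nul (he · b · kg)).
  { apply (mono_nul Mr). rewrite <- comp_assoc, <- E2. assoc.
    apply nul_compl, nul_compl, (ker_nul _ _ Kkg). }
  destruct (coker_desc (nepi_coker_ker Hge Kkg) _ _ Nl) as [l Hl].
  assert (Hle : nepi l).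
  { apply (nepi_cancel ge l Ege). now apply (nepi_eqv (eqv_sym Hl)). }
  assert (El : d · gm ≃ r · l).
  { apply (epi_right Ege). assoc. now rewrite E2, Hl. }
  (* The kernels of [g] and of [b] both lie in [p], the kernel of [he · b]. *)
  destruct (ker_lift Kp _ _ Nl) as [n Hn].
  destruct (proj1 HC _ _ l) as (K & k & Kk).
  destruct (third_iso HC HD Kkg (nepi_coker_ker Hge Kkg) (eqv_sym Hn) Kp Qp
              Hl Kk) as (ep & Eep & Qep & Kep).
  assert (Nm : nul (he · b · m)).
  { rewrite comp_assoc. apply nul_compl, (ker_nul _ _ Km). }
  destruct (ker_lift Kp _ _ Nm) as [m1 Hm1].
  destruct (third_iso HC HD Km Qm (eqv_sym Hm1) Kp Qp (reflexivity _) Kkh)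
    as (eb & Eeb & Qeb & Keb).
  assert (Eb1 : b1 ≃ eb · n).
  { apply (ker_mono _ _ Kkh). rw Eb. rewrite <- Hn. rw Eeb. reflexivity. }
  (* [K] is the inverse image along [c] of the image of [g]. *)
  assert (Nx : nul (d · (gm · k))).
  { rw El. apply nul_compl, (ker_nul _ _ Kk). }
  destruct (ker_lift Kc _ _ Nx) as [x Hx].
  assert (Kx : ker (qg · c) x).
  { split; [|split].
    - rw Hx. rewrite <- comp_assoc. apply nul_compr, (coker_nul Qqg).
    - intros T z Hz. rewrite comp_assoc in Hz.
      destruct (ker_lift (nmono_ker_coker Hgm Qqg) _ _ Hz) as [y Hy].
      assert (Ny : nul (l · y)).
      { apply (mono_nul Mr). rewrite <- comp_assoc, <- El, comp_assoc, Hy.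
        rewrite <- comp_assoc. apply nul_compr, (ker_nul _ _ Kc). }
      destruct (ker_lift Kk _ _ Ny) as [w Hw]. exists w. apply Mc.
      rw Hx. now rewrite Hw.
    - apply (mono_cancel c), (mono_eqv (gm · k)); [now symmetry|].
      apply mono_comp; [trivial | exact (ker_mono _ _ Kk)]. }
  assert (Mx := ker_mono _ _ Kx).
  (* The image of [f] lies in [x], as the normal subobject [j]. *)
  assert (Nf : nul (qg · c · fm)).
  { apply (epi_nul Es). assoc. rewrite <- E1, <- comp_assoc.
    apply nul_compr, (coker_nul Qqg). }
  destruct (ker_lift Kx _ _ Nf) as [j Hj].
  assert (Hjm : nmono j).
  { apply (nmono_cancel x j Mx). now apply (nmono_eqv (eqv_sym Hj)). }
  assert (Ejs : ep · m1 ≃ j · s).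
  { apply Mx, Mc. rw Hx. rw <- Eep.
    rewrite Hm1, E1, <- Hj. now assoc. }
  (* Dinversion of [(n, eb)], then of [(gm, d)]. *)
  assert (Hb1 : nmap b1).
  { apply (nmap_eqv (eqv_sym Eb1)).
    apply (HD _ _ _ _ _ n eb m1 ep); trivial.
    - exact (ker_nmono _ _ Kep).
    - exact (coker_nepi Qeb).
    - apply (nmap_eqv (eqv_sym Ejs)). now exists F, j, s. }
  assert (Hqc : nmap (qg · c)).
  { apply (HD _ _ _ _ _ gm d c qg); trivial.
    - exact (coker_nepi Qc).
    - apply (nmap_eqv (eqv_sym El)). now exists H, r, l. }
  split; [trivial|split].
  { apply (nmap_cancel_nepi HC qf c1); [exact (coker_nepi Qqf)|].
    exact (nmap_eqv (eqv_sym Ec) Hqc). }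
  destruct Hqc as (J & cm & ce & Hcm & Hce & Eqc).
  assert (Kce : ker ce x).
  { apply (ker_mono_comp (nmono_mono _ Hcm)).
    now apply (ker_eqv Eqc (reflexivity x)). }
  assert (Nce : nul (ce · fm)).
  { rewrite <- Hj, <- comp_assoc. apply nul_compr, (ker_nul _ _ Kce). }
  destruct (coker_desc Qqf _ _ Nce) as [q' Hq'].
  destruct (proj1 HC _ _ q') as (W & dm & Kdm).
  destruct (third_iso HC HD (nmono_ker_coker Hfm Qqf) Qqf (eqv_sym Hj) Kce
              (nepi_coker_ker Hce Kce) Hq' Kdm) as (e & Ee & Qe & _).
  assert (Ec1 : c1 ≃ cm · q').
  { apply (epi_right (coker_epi Qqf)). assoc. now rewrite Ec, Hq'. }
  (* [W] is the common quotient of [P] by the kernel of [g] and by [m]. *)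
  assert (Nde : nul (e · ep · m1)).
  { rewrite comp_assoc, Ejs, <- comp_assoc. apply nul_compr, (coker_nul Qe). }
  destruct (coker_desc Qeb _ _ Nde) as [de Hde].
  exists W, de, dm. split.
  - apply (coker_eqv (eqv_sym Eb1) (reflexivity de)), coker_intro.
    + rw Hde. apply nul_compl, (coker_nul Qep).
    + intros T z Hz. rewrite <- comp_assoc in Hz.
      destruct (coker_desc Qep _ _ Hz) as [w Hw].
      assert (Nw : nul (w · j)).
      { apply (epi_nul Es). rewrite comp_assoc, <- Ejs, <- comp_assoc, Hw.
        rewrite comp_assoc. apply nul_compl, (coker_nul Qeb). }
      destruct (coker_desc Qe _ _ Nw) as [v Hv]. exists v.
      apply (epi_right (coker_epi Qeb)). rw Hde. rw Hv. exact Hw.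
    + apply (epi_cancel eb), (epi_eqv (e · ep)); [now symmetry|].
      exact (mono_comp (C := opp C) _ _ (coker_epi Qep) (coker_epi Qe)).
  - apply (ker_eqv (eqv_sym Ec1) (reflexivity dm)).
    apply (ker_mono_comp (nmono_mono _ Hcm)), Kdm.
Qed.

(** * The snake in a category with null arrows *)

(** The rows are given through the normal factorisations [m · ae] of the first
    arrow of the top one and [dm · dv] of the last arrow of the bottom one. *)
Lemma snake_nec {C : zcat} (HC : z_exact C) (HD : dpn C) (HN : nec C)
  {A M B D X Y V Z Kf Kg Kh Qf Qg Qh : C}
  {ae : hom A M} {m : hom M B} {b : hom B D}
  {c : hom X Y} {dv : hom Y V} {dm : hom V Z}
  {f : hom A X} {g : hom B Y} {h : hom D Z}
  {kf : hom Kf A} {kg : hom Kg B} {kh : hom Kh D}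
  {qf : hom X Qf} {qg : hom Y Qg} {qh : hom Z Qh}
  {a1 : hom Kf Kg} {b1 : hom Kg Kh} {c1 : hom Qf Qg} {d1 : hom Qg Qh} :
  nepi ae -> ker b m -> nepi b -> nmono c -> coker c dv -> nmono dm ->
  g · (m · ae) ≃ c · f -> dm · dv · g ≃ h · b ->
  nmap f -> nmap g -> nmap h ->
  ker f kf -> ker g kg -> ker h kh ->
  coker f qf -> coker g qg -> coker h qh ->
  kg · a1 ≃ m · ae · kf -> kh · b1 ≃ b · kg ->
  c1 · qf ≃ qg · c -> d1 · qg ≃ qh · (dm · dv) ->
  exists del : hom Kh Qf,
    exact a1 b1 /\ exact b1 del /\ exact del c1 /\ exact c1 d1.
Proof.
  intros Hae Km Hb Hc Qc Hdm E1 E2 Hf Hg Hh Kkf Kkg Kkh Qqf Qqg Qqh Ea Eb Ec Ed.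
  destruct Hf as (F & fm & fe & Hfm & Hfe & Ef).
  destruct Hg as (G & gm & ge & Hgm & Hge & Eg).
  destruct Hh as (H & hm & he & Hhm & Hhe & Eh).
  assert (Mfm := nmono_mono _ Hfm). assert (Mgm := nmono_mono _ Hgm).
  assert (Mhm := nmono_mono _ Hhm). assert (Mc := nmono_mono _ Hc).
  assert (Efe := nepi_epi _ Hfe). assert (Ege := nepi_epi _ Hge).
  assert (Ehe := nepi_epi _ Hhe). assert (Ebe := nepi_epi _ Hb).
  assert (Kfe : ker fe kf)
    by exact (proj1 (ker_mono_comp Mfm) (ker_eqv Ef (reflexivity kf) Kkf)).
  assert (Kge : ker ge kg)
    by exact (proj1 (ker_mono_comp Mgm) (ker_eqv Eg (reflexivity kg) Kkg)).
  assert (Khe : ker he kh)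
    by exact (proj1 (ker_mono_comp Mhm) (ker_eqv Eh (reflexivity kh) Kkh)).
  assert (Qfm : coker fm qf)
    by exact (proj1 (coker_epi_comp Efe) (coker_eqv Ef (reflexivity qf) Qqf)).
  assert (Qgm : coker gm qg)
    by exact (proj1 (coker_epi_comp Ege) (coker_eqv Eg (reflexivity qg) Qqg)).
  assert (Qhm : coker hm qh)
    by exact (proj1 (coker_epi_comp Ehe) (coker_eqv Eh (reflexivity qh) Qqh)).
  rewrite Ef in E1. rewrite Eh in E2.
  destruct (coimage_factor HC Hae Mc Mfm Hfe E1) as (s & Es & Hs & Es').
  destruct (image_factor HC Hdm Ebe Ehe Hhm E2) as (r & Er & Hr & Er').
  destruct (snake_left HC HD Hae Km Mc Mfm Hfe E1 Kfe Kkg (ker_mono _ _ Kkh)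
              Ea Eb) as (K1 & k1 & e1 & Kk1 & He1 & Ea1).
  destruct (snake_left (C := opp C) (z_exact_opp _ HC) (dpn_opp _ HD)
              (ae := dm) (m := dv) (b := c) (c := b) (g := g) (fe := hm)
              (fm := he) (kf := qh) (kg := qg) (kh := qf) (a1 := d1) (b1 := c1)
              Hdm Qc Ebe Ehe Hhm E2 Qhm Qqg (coker_epi Qqf) Ed Ec)
    as (K2 & k2 & e2 & Kk2 & He2 & Ed2).
  assert (Es2 : gm · (ge · m) ≃ c · (fm · s)).
  { rewrite <- Es', Eg. now assoc. }
  assert (Er2 : dv · (gm · ge) ≃ r · (he · b)).
  { rewrite <- Eg, Er'. now assoc. }
  destruct (snake_middle HC HD HN Km (nepi_coker_ker Hb Km)
              (nmono_ker_coker Hc Qc) Qc Hs Hfm Hge Hgm Hhe Hr Es2 Er2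
              Kge Khe Qfm Qgm Eb Ec) as (Hb1 & Hc1 & W & de & dl & Qde & Kdl).
  assert (Hdl := ker_nmono _ _ Kdl). assert (Hde := coker_nepi Qde).
  exists (dl · de). split; [|split; [|split]].
  - exact (exact_of_ker Hb1 He1 Ea1 Kk1).
  - exact (exact_of_coker Hb1 Hdl (reflexivity _) Qde).
  - exact (exact_of_ker Hc1 Hde (reflexivity _) Kdl).
  - exact (exact_of_coker Hc1 He2 Ed2 Kk2).
Qed.

(** The hypotheses and the conclusion are self-dual, so that the composition
    axiom may also be the one on normal monomorphisms. *)
Lemma snake {C : zcat} (HC : z_exact C) (HD : dpn C) (HN : nec C \/ nec (opp C))
  {A M B D X Y V Z Kf Kg Kh Qf Qg Qh : C}
  {ae : hom A M} {m : hom M B} {b : hom B D}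
  {c : hom X Y} {dv : hom Y V} {dm : hom V Z}
  {f : hom A X} {g : hom B Y} {h : hom D Z}
  {kf : hom Kf A} {kg : hom Kg B} {kh : hom Kh D}
  {qf : hom X Qf} {qg : hom Y Qg} {qh : hom Z Qh}
  {a1 : hom Kf Kg} {b1 : hom Kg Kh} {c1 : hom Qf Qg} {d1 : hom Qg Qh} :
  nepi ae -> ker b m -> nepi b -> nmono c -> coker c dv -> nmono dm ->
  g · (m · ae) ≃ c · f -> dm · dv · g ≃ h · b ->
  nmap f -> nmap g -> nmap h ->
  ker f kf -> ker g kg -> ker h kh ->
  coker f qf -> coker g qg -> coker h qh ->
  kg · a1 ≃ m · ae · kf -> kh · b1 ≃ b · kg ->
  c1 · qf ≃ qg · c -> d1 · qg ≃ qh · (dm · dv) ->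
  exists del : hom Kh Qf,
    exact a1 b1 /\ exact b1 del /\ exact del c1 /\ exact c1 d1.
Proof.
  destruct HN as [HN | HN]; [exact (snake_nec HC HD HN)|].
  intros Hae Km Hb Hc Qc Hdm E1 E2 Hf Hg Hh Kkf Kkg Kkh Qqf Qqg Qqh Ea Eb Ec Ed.
  destruct (snake_nec (C := opp C) (z_exact_opp _ HC) (dpn_opp _ HD) HN
              (ae := dm) (m := dv) (b := c) (c := b) (dv := m) (dm := ae)
              (f := h) (g := g) (h := f) (kf := qh) (kg := qg) (kh := qf)
              (qf := kh) (qg := kg) (qh := kf)
              (a1 := d1) (b1 := c1) (c1 := b1) (d1 := a1)
              Hdm Qc Hc Hb Km Hae E2 E1 (proj1 (nmap_opp _) Hh)
              (proj1 (nmap_opp _) Hg) (proj1 (nmap_opp _) Hf)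
              Qqh Qqg Qqf Kkh Kkg Kkf Ed Ec Eb Ea)
    as (del & H1 & H2 & H3 & H4).
  exists del. split; [|split; [|split]]; now apply exact_opp.
Qed.

Lemma inv_opp {C : zcat} {A B : C} (f : hom A B) :
  @inv (opp C) B A f <-> inv f.
Proof. split; intros (g & H1 & H2); now exists g. Qed.

Lemma ker_of_nul {C : zcat} {A B K : C} {f : hom A B} {k : hom K A} :
  nul f -> ker f k -> inv k.
Proof.
  intros Hf Kk.
  destruct (ker_lift Kk _ (one A) (nul_compr _ Hf)) as [u Hu].
  exists u. split; trivial. apply (ker_mono _ _ Kk).
  rewrite <- comp_assoc, Hu, comp_one_l, comp_one_r. reflexivity.
Qed.

Lemma nmono_inv {C : zcat} {A K K' : C} {k : hom K A} {u : hom K' K} :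
  nmono k -> inv u -> nmono (k · u).
Proof. intros (B & f & Kk) Hu. exists B, f. now apply ker_inv. Qed.

Lemma nepi_inv {C : zcat} {B Q Q' : C} {e : hom B Q} {u : hom Q Q'} :
  nepi e -> inv u -> nepi (u · e).
Proof.
  intros He Hu. exact (nmono_inv (C := opp C) He (proj2 (inv_opp u) Hu)).
Qed.

(** A normal arrow whose kernel is covered by a zero object is a normal
    monomorphism. *)
Lemma nmono_of_zero_ker {C : zcat} {O I X Y : C} {c : hom X Y} {k : hom I X}
  {e : hom O I} : nul (one O) -> ker c k -> nepi e -> nmap c -> nmono c.
Proof.
  intros HO Kk He (J & m & q & Hm & Hq & E).
  assert (Ne : nul e) by (rewrite <- (comp_one_r _ _ _ e); now apply nul_compl).
  assert (Nk : nul k) by (apply (epi_nul (nepi_epi _ He)); now apply nul_compl).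
  assert (Qq : coker k q).
  { apply (nepi_coker_ker Hq), (ker_mono_comp (nmono_mono _ Hm)).
    exact (ker_eqv E (reflexivity k) Kk). }
  apply (nmono_eqv (eqv_sym E)), (nmono_inv Hm), inv_opp.
  exact (ker_of_nul (C := opp C) Nk Qq).
Qed.

(** * The quotient of a 2-category by its invertible 2-cells *)

Lemma isomorphic_refl {C : category} (x : C) : isomorphic x x.
Proof. exists (idm x), (idm x). now rewrite cmp_idl. Qed.

Lemma isomorphic_sym {C : category} (x y : C) : isomorphic x y -> isomorphic y x.
Proof. intros (f & g & H1 & H2). now exists g, f. Qed.

Lemma isomorphic_trans {C : category} (x y z : C) :
  isomorphic x y -> isomorphic y z -> isomorphic x z.
Proof.
  intros (f & f' & H1 & H2) (g & g' & H3 & H4).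
  exists (cmp g f), (cmp f' g'). split.
  - now rewrite <- cmp_assoc, (cmp_assoc g'), H3, cmp_idl.
  - now rewrite <- cmp_assoc, (cmp_assoc f), H2, cmp_idl.
Qed.

Lemma comp1_iso {L : twocat} {A B C : L} (g g' : cell1 B C) (f f' : cell1 A B) :
  g ≅ g' -> f ≅ f' -> g ∘ f ≅ g' ∘ f'.
Proof.
  intros (p & p' & H1 & H2) (q & q' & H3 & H4).
  exists (hcomp p q), (hcomp p' q').
  split; rewrite <- interchange, ?H1, ?H2, ?H3, ?H4; apply hcomp_id.
Qed.

(** The only 2-cell from a null 1-cell to itself is the identity. *)
Lemma null_iso {L : twocat} {zero : L} (H : strong_bizero zero) {A B : L}
  (f g : cell1 A B) : null zero f -> null zero g -> f ≅ g.
Proof.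
  intros Nf Ng.
  assert (U : forall (x : cell1 A B), null zero x ->
            forall a : x ⇒ x, a = idm x).
  { intros x Nx a. destruct (proj2 H _ _ _ _ Nx Nx) as (a0 & _ & Ha0).
    now rewrite <- (Ha0 a I), <- (Ha0 (idm x) I). }
  destruct (proj2 H _ _ _ _ Nf Ng) as (p & _).
  destruct (proj2 H _ _ _ _ Ng Nf) as (q & _).
  exists p, q. split; now apply U.
Qed.

Lemma null_exists {L : twocat} {zero : L} (H : strong_bizero zero) (A B : L) :
  exists f : cell1 A B, iso_null zero f.
Proof.
  destruct (proj1 (proj1 H A)) as (_ & p & _).
  destruct (proj2 (proj1 H B)) as (_ & q & _).
  exists (q tt ∘ p tt), (q tt ∘ p tt). split; [now exists (p tt), (q tt)|].
  apply isomorphic_refl.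
Qed.

Lemma iso_null_all {L : twocat} {zero : L} (H : strong_bizero zero) {A B : L}
  (f g : cell1 A B) : iso_null zero f -> iso_null zero g -> f ≅ g.
Proof.
  intros (m & Nm & Em) (n & Nn & En).
  apply isomorphic_trans with m; trivial.
  apply isomorphic_trans with n; [now apply (null_iso H)|].
  now apply isomorphic_sym.
Qed.

Lemma iso_null_iso {L : twocat} (zero : L) {A B : L} (f g : cell1 A B) :
  f ≅ g -> iso_null zero f -> iso_null zero g.
Proof.
  intros E (n & Nn & En). exists n. split; trivial.
  apply isomorphic_trans with f; trivial. now apply isomorphic_sym.
Qed.

Lemma iso_null_compl {L : twocat} (zero : L) {A B C : L} (g : cell1 B C)
  (f : cell1 A B) : iso_null zero f -> iso_null zero (g ∘ f).
Proof.
  intros (n & (p & q & Hn) & En). exists (g ∘ n). split.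
  - exists p, (g ∘ q). rewrite Hn. apply comp1_assoc.
  - apply comp1_iso; trivial. apply isomorphic_refl.
Qed.

Lemma iso_null_compr {L : twocat} (zero : L) {A B C : L} (g : cell1 B C)
  (f : cell1 A B) : iso_null zero g -> iso_null zero (g ∘ f).
Proof.
  intros (n & (p & q & Hn) & En). exists (n ∘ f). split.
  - exists (p ∘ f), q. rewrite Hn. symmetry. apply comp1_assoc.
  - apply comp1_iso; trivial. apply isomorphic_refl.
Qed.

(** Arrows are the 1-cells, congruence is isomorphism, and the null arrows are the
    1-cells isomorphic to one that factors through the bizero object. *)
Definition homotopy {L : twocat} {zero : L} (H : strong_bizero zero) : zcat :=
  @ZCat L (fun A B => cell1 A B) (fun A B f g => f ≅ g) (@id1 L) (@comp1 L)
    (fun A B f => iso_null zero f)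
    (fun A B => @isomorphic_refl (cell1 A B))
    (fun A B => @isomorphic_sym (cell1 A B))
    (fun A B => @isomorphic_trans (cell1 A B))
    (@comp1_iso L) (@comp1_idl L) (@comp1_idr L)
    (fun A B C D h g f => eq_sym (comp1_assoc h g f))
    (null_exists H) (@iso_null_all L zero H) (@iso_null_iso L zero)
    (@iso_null_compl L zero) (@iso_null_compr L zero).

(** ** Fully faithful 1-cells *)

Definition bijective {S T : Type} (F : S -> T) : Prop :=
  forall t : T, exists! s : S, F s = t.

(** Whiskering with [k] is fully faithful: the second universal property of a
    2-kernel. *)
Definition fully_faithful {L : twocat} {K A : L} (k : cell1 K A) : Prop :=
  forall (Z : L) (u v : cell1 Z K),
    bijective (fun mu : u ⇒ v => whisker_left k mu).

Lemma bijective_inj {S T : Type} (F : S -> T) :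
  bijective F -> forall s s', F s = F s' -> s = s'.
Proof.
  intros H s s' E. destruct (H (F s')) as (x & _ & Hx).
  now rewrite <- (Hx s E), <- (Hx s' eq_refl).
Qed.

Lemma bijective_intro {S T : Type} (F : S -> T) :
  (forall s s', F s = F s' -> s = s') -> (forall t, exists s, F s = t) ->
  bijective F.
Proof.
  intros H1 H2 t. destruct (H2 t) as [s Hs]. exists s. split; trivial.
  intros s' Hs'. apply H1. congruence.
Qed.

Lemma bijective_comp {S T U : Type} (F : S -> T) (G : T -> U) :
  bijective F -> bijective G -> bijective (fun s => G (F s)).
Proof.
  intros HF HG. apply bijective_intro.
  - intros s s' E. now apply (bijective_inj _ HF), (bijective_inj _ HG).
  - intro u. destruct (HG u) as (t & Ht & _). destruct (HF t) as (s & Hs & _).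
    exists s. congruence.
Qed.

(** If [G ∘ F] and [H ∘ G] are bijective, then so is [F]. *)
Lemma bijective_two_of_six {S T U V : Type} (F : S -> T) (G : T -> U)
  (H : U -> V) :
  bijective (fun s => G (F s)) -> bijective (fun t => H (G t)) -> bijective F.
Proof.
  intros HGF HHG.
  assert (IG : forall t t', G t = G t' -> t = t').
  { intros t t' E. apply (bijective_inj _ HHG). now rewrite E. }
  apply bijective_intro.
  - intros s s' E. apply (bijective_inj _ HGF). now rewrite E.
  - intro t. destruct (HGF (G t)) as (s & Hs & _). exists s. now apply IG.
Qed.

Lemma bijective_cast2 {C : category} {S : Type} {x x' y y' : C} (ex : x = x')
  (ey : y = y') (F : S -> mor x y) :
  bijective (fun s => cast2 ex ey (F s)) <-> bijective F.
Proof. destruct ex, ey. reflexivity. Qed.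

Lemma bijective_ext {S T : Type} (F G : S -> T) :
  (forall s, F s = G s) -> bijective F -> bijective G.
Proof.
  intros E H t. destruct (H t) as (s & Hs & U). exists s. split.
  - now rewrite <- E.
  - intros s' Hs'. apply U. now rewrite E.
Qed.

Lemma fully_faithful_comp_iff {L : twocat} {K A B Z : L} (m : cell1 A B)
  (k : cell1 K A) (u v : cell1 Z K) :
  bijective (fun mu : u ⇒ v => whisker_left (m ∘ k) mu) <->
  bijective (fun mu : u ⇒ v => whisker_left m (whisker_left k mu)).
Proof.
  assert (E : forall mu : u ⇒ v,
    cast2 (comp1_assoc m k u) (comp1_assoc m k v)
      (whisker_left m (whisker_left k mu)) = whisker_left (m ∘ k) mu).
  { intro mu. unfold whisker_left. now rewrite hcomp_assoc, hcomp_id. }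
  split; intro H.
  - apply (bijective_cast2 (comp1_assoc m k u) (comp1_assoc m k v)).
    revert H. apply bijective_ext. intro s. now rewrite E.
  - apply (bijective_cast2 (comp1_assoc m k u) (comp1_assoc m k v)) in H.
    revert H. apply bijective_ext. exact E.
Qed.

Lemma fully_faithful_id {L : twocat} (A : L) : fully_faithful (id1 A).
Proof.
  intros Z u v. apply (bijective_cast2 (comp1_idl u) (comp1_idl v)).
  apply (bijective_ext (fun mu => mu)).
  - intro mu. symmetry. apply hcomp_idl.
  - intro mu. exists mu. now split.
Qed.

Lemma fully_faithful_iso {L : twocat} {K A : L} (k k' : cell1 K A) :
  k ≅ k' -> fully_faithful k -> fully_faithful k'.
Proof.
  intros (phi & psi & H1 & H2) H Z u v.
  assert (N : forall mu : u ⇒ v, whisker_left k' mu =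
    cmp (hcomp phi (idm v)) (cmp (whisker_left k mu) (hcomp psi (idm u)))).
  { intro mu. unfold whisker_left.
    now rewrite <- !interchange, !cmp_idl, cmp_idr, H2. }
  refine (bijective_ext _ _ (fun mu => eq_sym (N mu)) _).
  refine (bijective_comp _
    (fun x => cmp (hcomp phi (idm v)) (cmp x (hcomp psi (idm u)))) (H Z u v) _).
  assert (V1 : cmp (hcomp psi (idm v)) (hcomp phi (idm v)) = idm (k ∘ v))
    by now rewrite <- interchange, H1, cmp_idl, hcomp_id.
  assert (V2 : cmp (hcomp phi (idm v)) (hcomp psi (idm v)) = idm (k' ∘ v))
    by now rewrite <- interchange, H2, cmp_idl, hcomp_id.
  assert (U1 : cmp (hcomp psi (idm u)) (hcomp phi (idm u)) = idm (k ∘ u))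
    by now rewrite <- interchange, H1, cmp_idl, hcomp_id.
  assert (U2 : cmp (hcomp phi (idm u)) (hcomp psi (idm u)) = idm (k' ∘ u))
    by now rewrite <- interchange, H2, cmp_idl, hcomp_id.
  apply bijective_intro.
  - intros x y E.
    assert (R : forall x : k ∘ u ⇒ k ∘ v, x =
      cmp (hcomp psi (idm v)) (cmp (cmp (hcomp phi (idm v))
        (cmp x (hcomp psi (idm u)))) (hcomp phi (idm u)))).
    { intro w. now rewrite <- !cmp_assoc, U1, cmp_idr, cmp_assoc, V1, cmp_idl. }
    now rewrite (R x), (R y), E.
  - intro t.
    exists (cmp (hcomp psi (idm v)) (cmp t (hcomp phi (idm u)))).
    now rewrite <- !cmp_assoc, U2, cmp_idr, cmp_assoc, V2, cmp_idl.
Qed.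

(** An equivalence is fully faithful, hence so is its composite with a fully
    faithful 1-cell. *)
Lemma fully_faithful_equiv {L : twocat} {K K' A : L} (k : cell1 K A)
  (k' : cell1 K' A) (u : cell1 K' K) (v : cell1 K K') :
  fully_faithful k -> k ∘ u ≅ k' -> u ∘ v ≅ id1 K -> v ∘ u ≅ id1 K' ->
  fully_faithful k'.
Proof.
  intros Hk E Huv Hvu. apply (fully_faithful_iso _ _ E). intros Z x y.
  apply fully_faithful_comp_iff.
  refine (bijective_comp _ (fun m => whisker_left k m) _ (Hk _ _ _)).
  apply (bijective_two_of_six _ (fun m => whisker_left v m)
           (fun m => whisker_left u m)); apply fully_faithful_comp_iff.
  - apply (fully_faithful_iso _ _ (isomorphic_sym _ _ Hvu)), fully_faithful_id.
  - apply (fully_faithful_iso _ _ (isomorphic_sym _ _ Huv)), fully_faithful_id.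
Qed.

Lemma fully_faithful_reflects_iso {L : twocat} {K A Z : L} (k : cell1 K A)
  (u v : cell1 Z K) : fully_faithful k -> k ∘ u ≅ k ∘ v -> u ≅ v.
Proof.
  intros Hk (p & q & H1 & H2).
  destruct (Hk _ _ _ p) as (m & Hm & _). destruct (Hk _ _ _ q) as (n & Hn & _).
  exists m, n. unfold whisker_left in Hm, Hn.
  split; apply (bijective_inj _ (Hk _ _ _)); unfold whisker_left;
    rewrite hcomp_id.
  - now rewrite <- H1, <- Hm, <- Hn, <- interchange, cmp_idl.
  - now rewrite <- H2, <- Hm, <- Hn, <- interchange, cmp_idl.
Qed.

(** The associativity of [op2] below runs against that of the given 2-category. *)
Lemma cast2_op {C : category} {x x' y y' : C} (ex : x = x') (ey : y = y')
  (f : mor x y) (g : mor x' y') :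
  cast2 ex ey f = g -> cast2 (eq_sym ex) (eq_sym ey) g = f.
Proof. destruct ex, ey. simpl. congruence. Qed.

(** The 2-category with its 1-cells reversed and its 2-cells kept. *)
Definition op2 (L : twocat) : twocat :=
  @Twocat L (fun A B => @cell1 L B A) (@id1 L)
    (fun A B C g f => @comp1 L C B A f g)
    (fun A B C g g' f f' b a => @hcomp L C B A f f' g g' a b)
    (fun A B C g f => @hcomp_id L C B A f g)
    (fun A B C g g' g'' f f' f'' b' b a' a =>
       @interchange L C B A f f' f'' g g' g'' a' a b' b)
    (fun A B => @comp1_idr L B A) (fun A B => @comp1_idl L B A)
    (fun A B C D h g f => eq_sym (@comp1_assoc L D C B A f g h))
    (fun A B => @hcomp_idr L B A) (fun A B => @hcomp_idl L B A)
    (fun A B C D h h' g g' f f' c b a =>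
       cast2_op _ _ _ _ (@hcomp_assoc L D C B A f f' g g' h h' a b c)).

(** ** 2-kernels are kernels in the quotient *)

Lemma is_2kernel_iff {L : twocat} {zero : L} (HL : two_z_exact zero) {A B K : L}
  (f : cell1 A B) (k : cell1 K A) :
  is_2kernel zero f k <-> ker (C := homotopy (proj1 HL)) f k.
Proof.
  assert (F : forall (K : L) (k : cell1 K A), is_2kernel zero f k ->
            ker (C := homotopy (proj1 HL)) f k).
  { intros K' k' (H1 & H2 & H3). split; [|split]; trivial.
    intros Z u v. now apply fully_faithful_reflects_iso. }
  split; [apply F|]. intro Kk. destruct (proj1 (proj2 HL) _ _ f) as (K0 & k0 & H0).
  split; [|split]; try apply Kk.
  destruct (ker_unique Kk (F _ _ H0)) as (u & (v & Hvu & Huv) & Eu).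
  exact (fully_faithful_equiv k0 k u v (proj2 (proj2 H0)) Eu Huv Hvu).
Qed.

Lemma is_2cokernel_iff {L : twocat} {zero : L} (HL : two_z_exact zero)
  {A B Q : L} (f : cell1 A B) (q : cell1 B Q) :
  is_2cokernel zero f q <-> coker (C := homotopy (proj1 HL)) f q.
Proof.
  assert (F : forall (Q : L) (q : cell1 B Q), is_2cokernel zero f q ->
            coker (C := homotopy (proj1 HL)) f q).
  { intros Q' q' (H1 & H2 & H3). apply coker_intro; trivial.
    intros Z u v. now apply (fully_faithful_reflects_iso (L := op2 L)). }
  split; [apply F|]. intro Kq. destruct (proj2 (proj2 HL) _ _ f) as (Q0 & q0 & H0).
  split; [|split]; try apply Kq.
  destruct (ker_unique (C := opp (homotopy (proj1 HL))) Kq (F _ _ H0))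
    as (u & (v & Hvu & Huv) & Eu).
  exact (fully_faithful_equiv (L := op2 L) q0 q u v (proj2 (proj2 H0)) Eu Huv Hvu).
Qed.

Lemma normal_2mono_iff {L : twocat} {zero : L} (HL : two_z_exact zero)
  {K A : L} (m : cell1 K A) :
  normal_2mono zero m <-> nmono (C := homotopy (proj1 HL)) m.
Proof.
  split; intros (B & f & H); exists B, f; revert H; now apply is_2kernel_iff.
Qed.

Lemma normal_2epi_iff {L : twocat} {zero : L} (HL : two_z_exact zero)
  {B Q : L} (e : cell1 B Q) :
  normal_2epi zero e <-> nepi (C := homotopy (proj1 HL)) e.
Proof.
  split; intros (A & f & H); exists A, f; revert H; now apply is_2cokernel_iff.
Qed.

Lemma normal_iff {L : twocat} {zero : L} (HL : two_z_exact zero)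
  {A B : L} (f : cell1 A B) :
  normal zero f <-> nmap (C := homotopy (proj1 HL)) f.
Proof.
  split; intros (I & m & e & Hm & He & E); exists I, m, e;
    (split; [|split; [|exact E]]);
    solve [now apply (normal_2mono_iff HL) | now apply (normal_2epi_iff HL)].
Qed.

Lemma exact_at_of_exact {L : twocat} {zero : L} (HL : two_z_exact zero)
  {A B C : L} (f : cell1 A B) (g : cell1 B C) :
  exact (C := homotopy (proj1 HL)) f g -> exact_at zero f g.
Proof.
  intros (I & J & m & e & n & q & (Hm & He & Ef) & (Hn & Hq & Eg) & Kq & _).
  split; [|split].
  - apply (normal_iff HL). now exists I, m, e.
  - apply (normal_iff HL). now exists J, n, q.
  - exists I, m, e. split.
    + split; [|split; [|exact Ef]]; [now apply (normal_2mono_iff HL)|].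
      now apply (normal_2epi_iff HL).
    + apply (is_2kernel_iff HL), (ker_eqv (eqv_sym Eg) (reflexivity m)).
      apply ker_mono_comp; trivial. now apply nmono_mono.
Qed.

Lemma z_exact_homotopy {L : twocat} {zero : L} (HL : two_z_exact zero) :
  z_exact (homotopy (proj1 HL)).
Proof.
  split; intros A B f.
  - destruct (proj1 (proj2 HL) _ _ f) as (K & k & Hk).
    exists K, k. now apply is_2kernel_iff.
  - destruct (proj2 (proj2 HL) _ _ f) as (Q & q & Hq).
    exists Q, q. now apply is_2cokernel_iff.
Qed.

Lemma dpn_homotopy {L : twocat} {zero : L} (HL : two_z_exact zero) :
  DPN zero -> dpn (homotopy (proj1 HL)).
Proof.
  intros H K X R N Q m e k q Hm He Hk Hq.
  assert (E := H K X R m e (conj (proj2 (normal_2mono_iff HL m) Hm)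
    (proj2 (normal_2epi_iff HL e) He)) N Q (q ∘ k)).
  assert (D : dinversion zero m e (q ∘ k)).
  { exists k, q. split; [now apply (is_2kernel_iff HL)|].
    split; [now apply (is_2cokernel_iff HL) | reflexivity]. }
  specialize (E D). split; intro F; apply (normal_iff HL), E, (normal_iff HL), F.
Qed.

Lemma nec_homotopy {L : twocat} {zero : L} (HL : two_z_exact zero) :
  NEC zero \/ NMC zero ->
  nec (homotopy (proj1 HL)) \/ nec (opp (homotopy (proj1 HL))).
Proof.
  intros [H | H]; [left | right]; intros A B C e e' He He'.
  - apply (normal_2epi_iff HL), H; now apply (normal_2epi_iff HL).
  - apply (normal_2mono_iff HL), H; now apply (normal_2mono_iff HL).
Qed.

Lemma iso_null_one {L : twocat} {zero : L} (H : strong_bizero zero) :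
  nul (z := homotopy H) (one (z := homotopy H) zero).
Proof.
  exists (id1 zero ∘ id1 zero). split; [now exists (id1 zero), (id1 zero)|].
  rewrite comp1_idl. apply isomorphic_refl.
Qed.

(** * The snake lemma *)

Theorem theorem9p19
  (L : twocat) (zero : L)
  (HL : two_z_exact zero)
  (Hdpn : DPN zero)
  (Hnec : NEC zero \/ NMC zero)
  (A B C X Y Z : L)
  (a : cell1 A B) (b : cell1 B C) (p : cell1 C zero)
  (i : cell1 zero X) (c : cell1 X Y) (d : cell1 Y Z)
  (f : cell1 A X) (g : cell1 B Y) (h : cell1 C Z)
  (Hsq1 : g ∘ a ≅ c ∘ f)
  (Hsq2 : h ∘ b ≅ d ∘ g)
  (Htop : exact_chain zero (a ⨾ b ⨾ p ⨾ cnil))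
  (Hbot : exact_chain zero (i ⨾ c ⨾ d ⨾ cnil))
  (Hf : normal zero f) (Hg : normal zero g) (Hh : normal zero h)
  (Kf Kg Kh : L)
  (kf : cell1 Kf A) (kg : cell1 Kg B) (kh : cell1 Kh C)
  (Hkf : is_2kernel zero f kf)
  (Hkg : is_2kernel zero g kg)
  (Hkh : is_2kernel zero h kh)
  (Qf Qg Qh : L)
  (qf : cell1 X Qf) (qg : cell1 Y Qg) (qh : cell1 Z Qh)
  (Hqf : is_2cokernel zero f qf)
  (Hqg : is_2cokernel zero g qg)
  (Hqh : is_2cokernel zero h qh) :
  (exists a_ : cell1 Kf Kg, kg ∘ a_ ≅ a ∘ kf) /\
  (exists b_ : cell1 Kg Kh, kh ∘ b_ ≅ b ∘ kg) /\
  (exists c_ : cell1 Qf Qg, c_ ∘ qf ≅ qg ∘ c) /\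
  (exists d_ : cell1 Qg Qh, d_ ∘ qg ≅ qh ∘ d) /\
  (exists del : cell1 Kh Qf,
     forall (a_ : cell1 Kf Kg) (b_ : cell1 Kg Kh)
            (c_ : cell1 Qf Qg) (d_ : cell1 Qg Qh),
       kg ∘ a_ ≅ a ∘ kf -> kh ∘ b_ ≅ b ∘ kg ->
       c_ ∘ qf ≅ qg ∘ c -> d_ ∘ qg ≅ qh ∘ d ->
       exact_chain zero (a_ ⨾ b_ ⨾ del ⨾ c_ ⨾ d_ ⨾ cnil)) /\
  (is_2kernel zero b a ->
     forall (a_ : cell1 Kf Kg) (b_ : cell1 Kg Kh),
       kg ∘ a_ ≅ a ∘ kf -> kh ∘ b_ ≅ b ∘ kg ->
       is_2kernel zero b_ a_) /\
  (is_2cokernel zero c d ->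
     forall (c_ : cell1 Qf Qg) (d_ : cell1 Qg Qh),
       c_ ∘ qf ≅ qg ∘ c -> d_ ∘ qg ≅ qh ∘ d ->
       is_2cokernel zero c_ d_).
Proof.
  set (T := homotopy (proj1 HL)).
  assert (HT : z_exact T) by exact (z_exact_homotopy HL).
  assert (E1 : @eqv T _ _ (@comp T _ _ _ g a) (@comp T _ _ _ c f)) by exact Hsq1.
  assert (E2 : @eqv T _ _ (@comp T _ _ _ h b) (@comp T _ _ _ d g)) by exact Hsq2.
  apply (is_2kernel_iff HL) in Hkf, Hkg, Hkh.
  apply (is_2cokernel_iff HL) in Hqf, Hqg, Hqh.
  apply (normal_iff HL) in Hf, Hg, Hh.
  fold T in Hkf, Hkg, Hkh, Hqf, Hqg, Hqh, Hf, Hg, Hh.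
  destruct Htop as (_ & (_ & Hb & M & m & ae & (Hm & Hae & Ea) & Km) & _ &
    (_ & _ & I & n & be & (Hn & Hbe & Eb) & Kn) & _).
  destruct Hbot as (_ & (_ & Hc & J & j & ie & (Hj & Hie & Ei) & Kj) & _ &
    (_ & Hd & U & cm & ce & (Hcm & Hce & Ec) & Kcm) & _).
  destruct Hd as (V & dm & dv & Hdm & Hdv & Ed).
  apply (normal_2mono_iff HL) in Hcm, Hdm.
  apply (normal_2epi_iff HL) in Hae, Hbe, Hie, Hce, Hdv.
  apply (is_2kernel_iff HL) in Km, Kn, Kj, Kcm.
  apply (normal_iff HL) in Hc.
  fold T in Hcm, Hdm, Hae, Hbe, Hie, Hce, Hdv, Km, Kn, Kj, Kcm, Hc.
  change (@eqv T _ _ a (@comp T _ _ _ m ae)) in Ea.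
  change (@eqv T _ _ b (@comp T _ _ _ n be)) in Eb.
  change (@eqv T _ _ c (@comp T _ _ _ cm ce)) in Ec.
  change (@eqv T _ _ d (@comp T _ _ _ dm dv)) in Ed.
  assert (N1 : @nul T _ _ (@one T zero)) by exact (iso_null_one (proj1 HL)).
  (* Exactness at [C]: the image of [b] is the kernel of a null arrow, hence
     invertible. *)
  assert (Np : @nul T _ _ p).
  { rewrite <- (comp_one_l _ _ _ (p : @hom T C zero)). now apply nul_compr. }
  assert (Hbn : @nepi T _ _ b).
  { apply (nepi_eqv (eqv_sym Eb)), (nepi_inv Hbe), (ker_of_nul Np Kn). }
  assert (Hcn : @nmono T _ _ c) by exact (nmono_of_zero_ker N1 Kj Hie Hc).
  assert (Qc : @coker T _ _ _ c dv).
  { apply (coker_eqv (eqv_sym Ec) (eqv_refl T _ _ dv)).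
    apply (coker_epi_comp (nepi_epi _ Hce)), (nepi_coker_ker Hdv).
    apply (ker_mono_comp (nmono_mono _ Hdm)).
    exact (ker_eqv Ed (eqv_refl T _ _ _) Kcm). }
  assert (Xa : exists a_ : cell1 Kf Kg, kg ∘ a_ ≅ a ∘ kf).
  { apply (ker_lift Hkg _ (@comp T _ _ _ a kf)).
    rewrite <- comp_assoc, E1, comp_assoc. apply nul_compl, (ker_nul _ _ Hkf). }
  assert (Xb : exists b_ : cell1 Kg Kh, kh ∘ b_ ≅ b ∘ kg).
  { apply (ker_lift Hkh _ (@comp T _ _ _ b kg)).
    rewrite <- comp_assoc, E2, comp_assoc. apply nul_compl, (ker_nul _ _ Hkg). }
  assert (Xc : exists c_ : cell1 Qf Qg, c_ ∘ qf ≅ qg ∘ c).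
  { apply (coker_desc Hqf _ (@comp T _ _ _ qg c)).
    rewrite comp_assoc, <- E1, <- comp_assoc. apply nul_compr, (coker_nul Hqg). }
  assert (Xd : exists d_ : cell1 Qg Qh, d_ ∘ qg ≅ qh ∘ d).
  { apply (coker_desc Hqg _ (@comp T _ _ _ qh d)).
    rewrite comp_assoc, <- E2, <- comp_assoc. apply nul_compr, (coker_nul Hqh). }
  do 4 (split; [assumption|]). split; [|split].
  - destruct Xa as [a0 Ha0], Xb as [b0 Hb0], Xc as [c0 Hc0], Xd as [d0 Hd0].
    assert (F1 : @eqv T _ _ (@comp T _ _ _ g (@comp T _ _ _ m ae))
                   (@comp T _ _ _ c f)) by now rewrite <- Ea.
    assert (F2 : @eqv T _ _ (@comp T _ _ _ (@comp T _ _ _ dm dv) g)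
                   (@comp T _ _ _ h b)) by now rewrite <- Ed, E2.
    (* A connecting arrow for one choice of the induced arrows serves all others,
       because these are unique up to congruence. *)
    assert (S : forall a_ b_ c_ d_,
      kg ∘ a_ ≅ a ∘ kf -> kh ∘ b_ ≅ b ∘ kg ->
      c_ ∘ qf ≅ qg ∘ c -> d_ ∘ qg ≅ qh ∘ d ->
      exists del : @hom T Kh Qf, @exact T _ _ _ a_ b_ /\ @exact T _ _ _ b_ del /\
        @exact T _ _ _ del c_ /\ @exact T _ _ _ c_ d_).
    { intros a_ b_ c_ d_ Ga Gb Gc Gd.
      apply (snake HT (dpn_homotopy HL Hdpn) (nec_homotopy HL Hnec)
               Hae Km Hbn Hcn Qc Hdm F1 F2 Hf Hg Hh Hkf Hkg Hkh Hqf Hqg Hqh);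
        trivial.
      - now rewrite <- Ea.
      - now rewrite <- Ed. }
    destruct (S _ _ _ _ Ha0 Hb0 Hc0 Hd0) as (del & S1 & S2 & S3 & S4).
    exists del. intros a_ b_ c_ d_ Ga Gb Gc Gd.
    assert (Fa : @eqv T _ _ a0 a_).
    { apply (ker_mono _ _ Hkg).
      exact (isomorphic_trans _ _ _ Ha0 (isomorphic_sym _ _ Ga)). }
    assert (Fb : @eqv T _ _ b0 b_).
    { apply (ker_mono _ _ Hkh).
      exact (isomorphic_trans _ _ _ Hb0 (isomorphic_sym _ _ Gb)). }
    assert (Fc : @eqv T _ _ c0 c_).
    { apply (epi_right (coker_epi Hqf)).
      exact (isomorphic_trans _ _ _ Hc0 (isomorphic_sym _ _ Gc)). }
    assert (Fd : @eqv T _ _ d0 d_).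
    { apply (epi_right (coker_epi Hqg)).
      exact (isomorphic_trans _ _ _ Hd0 (isomorphic_sym _ _ Gd)). }
    apply (exact_eqv Fa Fb), (exact_at_of_exact HL) in S1.
    apply (exact_eqv Fb (eqv_refl T _ _ _)), (exact_at_of_exact HL) in S2.
    apply (exact_eqv (eqv_refl T _ _ _) Fc), (exact_at_of_exact HL) in S3.
    apply (exact_eqv Fc Fd), (exact_at_of_exact HL) in S4.
    simpl. pose proof S1 as (? & ? & _). pose proof S3 as (? & ? & _).
    pose proof S4 as (_ & ? & _). tauto.
  - intros Ka a_ b_ Ga Gb. apply (is_2kernel_iff HL) in Ka.
    apply (is_2kernel_iff HL).
    exact (ker_pullback Ka (nmono_mono _ Hcn) E1 Hkf Hkg (ker_mono _ _ Hkh) Ga Gb).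
  - intros Kd c_ d_ Gc Gd. apply (is_2cokernel_iff HL) in Kd.
    apply (is_2cokernel_iff HL).
    exact (ker_pullback (C := opp T) Kd (nepi_epi _ Hbn) (eqv_sym E2) Hqh Hqg
             (coker_epi Hqf) Gd Gc).
Qed.
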